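(* Let $\Omega,\mathcal O$, $\mu,\nu$, $\delta>0$, $\lambda,\Lambda$ and $\psi$ be as in the standing setup (so Assumption $(\mathrm A_\delta)$, (O), (I1), (I2) hold). There exist constants $C_0>0$ depending only on $n$, $L(\Omega)$, $L(\partial\psi(\Omega))$, and $\theta>1$, $\beta>0$ depending only on $n,\lambda,\Lambda$, such that the following holds. Let $\Omega'\subset\subset\Omega$ and suppose there is $\rho>C_0\delta$ such that condition $(\mathrm R_\rho)$ holds for $\Omega'$. Then for every $y\in\Omega'$ there exist constants $C,\overline C>0$, depending only on $\mathrm{dist}(y,\partial\Omega')$, $\rho$, $L(\partial\psi(\Omega))$, $\Omega$, $\lambda$, $\Lambda$ and $n$, such that $$0\le \psi(x)-\psi(y)-q\cdot(x-y)\le \overline C\,|x-y|^{1+\frac1\theta}$$ for all $q\in\partial\psi(y)$ and all $x\in\Omega'$ satisfying $$C\delta^{1/\beta}\le |x-y|\le \min\Big(\mathrm{dist}(y,\partial\Omega'),\ \frac{\rho}{2L(\partial\psi(\Omega))}\Big).$$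
   Context: Standing setup: $n\ge1$; $\Omega,\mathcal O\subset\mathbb R^n$ are bounded convex open sets; $\mu,\nu$ are Borel probability measures on $\mathbb R^n$ with $\mathrm{spt}\,\mu\subset\overline\Omega$, $\mathrm{spt}\,\nu\subset\overline{\mathcal O}$. Assumption $(\mathrm A_\delta)$ (for $\delta\ge0$): there exist $0<\lambda\le\Lambda$ such that $\lambda|B_r|\le\mu(B_r)\le\Lambda|B_r|$ for every ball $B_r\subset\Omega$ of radius $r\ge\delta$, and $\lambda|B_r|\le\nu(B_r)\le\Lambda|B_r|$ for every ball $B_r\subset\mathcal O$ of radius $r\ge\delta$ ($|\cdot|$ is Lebesgue measure). $\psi:\mathbb R^n\to\mathbb R$ is convex and satisfies (O) $\partial\psi(\mathbb R^n)\subset\overline{\mathcal O}$; (I1) $\mu(A)\le\nu(\partial\psi(A))$ for all Borel $A\subset\Omega$; (I2) $\nu(B)\le\mu(\partial\psi^*(B))$ for all Borel $B\subset\mathcal O$. Here $\partial\psi(x)$ is the subdifferential, $\partial\psi(A)=\bigcup_{x\in A}\partial\psi(x)$, and $\psi^*(z)=\sup_x(x\cdot z-\psi(x))$ is the Legendre transform. For $K\subset\mathbb R^n$, $\ell(K)$ is the radius of the largest ball contained in $K$ and $L(K)$ the radius of the smallest ball containing $K$. Sections: for $x_0\in\mathbb R^n$, $p_0\in\partial\psi(x_0)$, $t\ge0$, $S(x_0,p_0,t)=\{x\in\mathbb R^n:\psi(x)\le\psi(x_0)+p_0\cdot(x-x_0)+t\}$. Condition $(\mathrm R_\rho)$ for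 $\Omega'\subset\subset\Omega$: for every $x\in\Omega'$ there exists $p\in\partial\psi(x)$ with $S(x,p,\rho)\subset\Omega$. *)

(* Defs.v *)
(* Points of R^n are row vectors 'rV[R]_n, with the
   Euclidean inner product / norm written out explicitly (the library's norm on
   'rV is the max-norm). *)
From HB Require Import structures.
From mathcomp Require Import all_boot all_order all_algebra.
From mathcomp Require Import all_classical all_reals all_analysis.
Set Implicit Arguments. Unset Strict Implicit. Unset Printing Implicit Defensive.
Import Order.TTheory GRing.Theory Num.Theory.
Import numFieldNormedType.Exports.
Local Open Scope classical_set_scope.
Local Open Scope ring_scope.

Section Defs.
Variables (R : realType) (n : nat).
Local Notation V := 'rV[R]_n.

Definition dot (x y : V) : R := \sum_(i < n) x ord0 i * y ord0 i.
Definition enorm (x : V) : R := Num.sqrt (dot x x).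

Definition eball (c : V) (r : R) : set V := [set x | enorm (x - c) < r].
Definition ecball (c : V) (r : R) : set V := [set x | enorm (x - c) <= r].

Definition borelV := g_sigma_algebraType (@open V).

(* outer measure induced by a measure (used to evaluate measures on sets such
   as subdifferential images, which are universally measurable) *)
Definition mstar (mu : set borelV -> \bar R) (A : set V) : \bar R :=
  ereal_inf [set mu B | B in [set B : set borelV | measurable B /\ A `<=` B]].

Definition spt (mu : set borelV -> \bar R) : set V :=
  [set x | forall r : R, 0 < r -> (0 < mu (eball x r))%E].

Definition bounded_set (A : set V) : Prop :=
  exists M : R, forall x, A x -> enorm x <= M.

Definition convex_set (A : set V) : Prop :=
  forall x y (t : R), A x -> A y -> 0 <= t -> t <= 1 ->
    A (t *: x + (1 - t) *: y).

Definition bounded_convex_open (A : set V) : Prop :=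
  open A /\ bounded_set A /\ convex_set A.

Definition convex_fun (f : V -> R) : Prop :=
  forall x y (t : R), 0 <= t -> t <= 1 ->
    f (t *: x + (1 - t) *: y) <= t * f x + (1 - t) * f y.

Definition subdiff (f : V -> R) (x : V) : set V :=
  [set p | forall z, f x + dot p (z - x) <= f z].
Definition subdiff_img (f : V -> R) (A : set V) : set V :=
  \bigcup_(x in A) subdiff f x.

Definition legendre (f : V -> R) (z : V) : \bar R :=
  ereal_sup [set ((dot x z - f x)%:E) | x in [set: V]].

Definition esubdiff (f : V -> \bar R) (z : V) : set V :=
  [set x | f z \is a fin_num /\ forall w, (f z + (dot x (w - z))%:E <= f w)%E].
Definition esubdiff_img (f : V -> \bar R) (B : set V) : set V :=
  \bigcup_(z in B) esubdiff f z.

(* volume of the unit ball of R^k : omega_0 = 1, omega_1 = 2,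
   omega_(k+2) = 2 pi / (k+2) * omega_k *)
Fixpoint omega (k : nat) : R :=
  match k with
  | 0%N => 1
  | 1%N => 2
  | k'.+2 => 2 * pi / (k'.+2)%:R * omega k'
  end.

Definition ball_vol (r : R) : R := omega n * r ^+ n.

Definition Lrad (K : set V) : R :=
  inf [set r : R | 0 <= r /\ exists c : V, K `<=` ecball c r].

Definition dist_to_set (y : V) (S : set V) : R := inf [set enorm (y - z) | z in S].

Definition boundary (A : set V) : set V := closure A `\` interior A.

Definition cc_sub (Om' Om : set V) : Prop :=
  open Om' /\ compact (closure Om') /\ closure Om' `<=` Om.

Definition assumption_A (Om Oc : set V) (mu nu : set borelV -> \bar R)
  (delta lam Lam : R) : Prop :=
  0 < lam /\ lam <= Lam /\
  (forall (c : V) (r : R), delta <= r -> eball c r `<=` Om ->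
     ((lam * ball_vol r)%:E <= mu (eball c r) <= (Lam * ball_vol r)%:E)%E) /\
  (forall (c : V) (r : R), delta <= r -> eball c r `<=` Oc ->
     ((lam * ball_vol r)%:E <= nu (eball c r) <= (Lam * ball_vol r)%:E)%E).

Definition section (psi : V -> R) (x0 p0 : V) (t : R) : set V :=
  [set x | psi x <= psi x0 + dot p0 (x - x0) + t].

Definition cond_R (psi : V -> R) (Om Om' : set V) (rho : R) : Prop :=
  forall x, Om' x -> exists2 p, subdiff psi x p & section psi x p rho `<=` Om.

End Defs.

(* Main.v *)
(* Let [v] be [psi] minus its tangent plane at [x], for a slope such that the sections [S_T = {v
   <= T}], [T <= rho], stay in Omega. The heart of the proof is the estimate [slope_bound]: if
   [v z0 <= T / 2], a supporting plane of [psi] at [z0] passes at most [Theta T] below [psi x].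
   Indeed, call this defect [h] and let [p], [q] be the slopes at [x], [z0]. If [w] lies in a
   small multiple of the polar body of [S_T], the slopes [p + w + t (q - p)], [0 <= t <= 1 / 2],
   are attained in [S_T] only. Letting [t] run through the multiples of [T / h] one gets about
   [h / T] disjoint copies of the body, so by (I2) and the lower bound on [nu] their total
   volume is controlled by [mu(S_T)]. Conversely [mu(S_T)] is comparable with the mass of a
   shrunken copy of [S_T], on which the slopes lie in a multiple of one such body, so (I1)
   bounds [mu(S_T)] by the volume of a single body. Volumes are compared by counting balls of
   radius of order [delta], which is where [T >= K delta] enters; only the ratio [Lambda /
   lambda] and the dimension remain in [Theta], together with the shrinking factor needed to
   stay in Omega'.
   Applied at points [z0] of the boundary of a section, the estimate bounds the decay of [v]
   along rays from below, so low sections are small and contained in Omega', and the shrinking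
   factor can be taken to be 1. Applied with [z0 = y] and [x] running along a ray from [y], it
   says that the excess [f] of [psi] over its tangent plane at [y] satisfies [f s <= 2 Theta (s
   f'(s) - f s)] unless [f s = O(delta)], whence [f (2 s) >= (2 + 1 / (2 Theta)) f s]; iterating
   gives the exponent [log_2 (2 + 1 / (2 Theta)) > 1], which is both [1 + 1 / theta] and [beta].
   The constant [C] makes [delta] small with respect to all other data, so [C0 = 1] suffices. *)
Require Import Defs.
From HB Require Import structures.
From mathcomp Require Import all_boot all_order all_algebra perm.
From mathcomp Require Import all_classical all_reals all_analysis.
From mathcomp Require Import ring lra.
Import Order.TTheory GRing.Theory Num.Theory.
Import numFieldNormedType.Exports.
Local Open Scope classical_set_scope.
Local Open Scope ring_scope.
Set Implicit Arguments.
Unset Strict Implicit.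
Unset Printing Implicit Defensive.

(** * The Euclidean norm and its topology *)

Section Euclid.
Variables (R : realType) (n : nat).
Local Notation V := 'rV[R]_n.
Implicit Types (x y z : V) (A : set V) (r : R).

Lemma dotC x y : dot x y = dot y x.
Proof. by apply: eq_bigr => i _; rewrite mulrC. Qed.

Lemma dotDl x y z : dot (x + y) z = dot x z + dot y z.
Proof. by rewrite -big_split; apply: eq_bigr => i _; rewrite /= mxE mulrDl. Qed.

Lemma dotZl r x z : dot (r *: x) z = r * dot x z.
Proof. by rewrite mulr_sumr; apply: eq_bigr => i _; rewrite mxE mulrA. Qed.

Lemma dotNl x z : dot (- x) z = - dot x z.
Proof. by rewrite -scaleN1r dotZl mulN1r. Qed.

Lemma dotBl x y z : dot (x - y) z = dot x z - dot y z.
Proof. by rewrite dotDl dotNl. Qed.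

Lemma dotDr x y z : dot z (x + y) = dot z x + dot z y.
Proof. by rewrite dotC dotDl !(dotC z). Qed.

Lemma dotZr r x z : dot z (r *: x) = r * dot z x.
Proof. by rewrite dotC dotZl (dotC z). Qed.

Lemma dotNr x z : dot z (- x) = - dot z x.
Proof. by rewrite dotC dotNl (dotC z). Qed.

Lemma dotBr x y z : dot z (x - y) = dot z x - dot z y.
Proof. by rewrite dotDr dotNr. Qed.

Lemma dot0l z : dot 0 z = 0.
Proof. by rewrite -(subrr z) dotBl subrr. Qed.

Lemma dot0r z : dot z 0 = 0.
Proof. by rewrite dotC dot0l. Qed.

Definition dotE :=
  (dotDl, dotDr, dotBl, dotBr, dotZl, dotZr, dotNl, dotNr, dot0l, dot0r).

Lemma dot_ge0 x : 0 <= dot x x.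
Proof. by apply: sumr_ge0 => i _; rewrite -expr2 sqr_ge0. Qed.

Lemma enorm_ge0 x : 0 <= enorm x.
Proof. exact: sqrtr_ge0. Qed.

Lemma enorm_sqr x : enorm x ^+ 2 = dot x x.
Proof. by rewrite sqr_sqrtr ?dot_ge0. Qed.

Lemma enorm0 : enorm (0 : V) = 0.
Proof. by rewrite /enorm dot0l sqrtr0. Qed.

Lemma enormN x : enorm (- x) = enorm x.
Proof. by rewrite /enorm !dotE opprK. Qed.

Lemma enormB x y : enorm (x - y) = enorm (y - x).
Proof. by rewrite -enormN opprB. Qed.

Lemma enormZ r x : enorm (r *: x) = `|r| * enorm x.
Proof.
by rewrite /enorm !dotE mulrA -expr2 sqrtrM ?sqr_ge0 // sqrtr_sqr.
Qed.

Lemma dot_enorm x y : dot x y <= enorm x * enorm y.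
Proof.
have [y0|y0] := eqVneq (dot y y) 0.
  suff -> : y = 0 by rewrite dot0r enorm0 mulr0.
  apply/rowP => i; rewrite mxE; apply/eqP; rewrite -sqrf_eq0 expr2.
  move/eqP: y0; rewrite psumr_eq0 => [/allP /(_ i)|j _].
    by rewrite ord1 mem_index_enum => /(_ isT).
  by rewrite -expr2 sqr_ge0.
have yp : 0 < dot y y by rewrite lt_neqAle eq_sym y0 dot_ge0.
have := dot_ge0 (dot y y *: x - dot x y *: y).
have -> : dot (dot y y *: x - dot x y *: y) (dot y y *: x - dot x y *: y)
  = dot y y * (dot x x * dot y y - dot x y ^+ 2).
  by rewrite !dotE (dotC y x); ring.
rewrite pmulr_rge0 // subr_ge0 -!enorm_sqr -exprMn => h.
rewrite (le_trans (ler_norm _)) // -(ler_pXn2r (n := 2)) ?nnegrE //.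
  by rewrite real_normK ?num_real.
by rewrite mulr_ge0 ?enorm_ge0.
Qed.

Lemma ler_enormD x y : enorm (x + y) <= enorm x + enorm y.
Proof.
rewrite -(ler_pXn2r (n := 2)) ?nnegrE ?addr_ge0 ?enorm_ge0 //.
rewrite sqrrD !enorm_sqr !dotE (dotC y x).
have := dot_enorm x y; lra.
Qed.

Lemma enorm_dist_triangle y x z : enorm (x - z) <= enorm (x - y) + enorm (y - z).
Proof. by rewrite -(subrKA y x) ler_enormD. Qed.

Lemma enorm_sum_norm x : enorm x <= n%:R * `|x|.
Proof.
rewrite -(ler_pXn2r (n := 2)) ?nnegrE ?enorm_ge0 ?mulr_ge0 // enorm_sqr.
have nle : forall i, `|x ord0 i| <= `|x|.
  move=> i; rewrite [leRHS]/Num.norm /= mx_normrE.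
  by apply: (le_bigmax_cond _ (fun i => `|x i.1 i.2|) (j := (ord0, i))).
have : dot x x <= \sum_(i < n) `|x| ^+ 2.
  apply: ler_sum => i _; rewrite -expr2 -real_normK ?num_real //.
  by rewrite ler_pXn2r ?nnegrE.
rewrite sumr_const card_ord => h; apply: le_trans h _.
rewrite exprMn -[leLHS]mulr_natl ler_wpM2r ?sqr_ge0 // -natrX ler_nat.
by case: (n) => // k; rewrite -mulnn leq_pmulr.
Qed.

Lemma norm_enorm x : `|x| <= enorm x.
Proof.
rewrite [leLHS]/Num.norm /= mx_normrE; apply/bigmax_leP; split=> [|[i j] _ /=].
  exact: enorm_ge0.
rewrite -(ler_pXn2r (n := 2)) ?nnegrE ?enorm_ge0 // enorm_sqr.
rewrite real_normK ?num_real // /dot (bigD1 j) //= ord1 expr2 lerDl.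
by apply: sumr_ge0 => k _; rewrite -expr2 sqr_ge0.
Qed.

Lemma enorm_eq0 x : enorm x = 0 -> x = 0.
Proof. by move=> h; apply/eqP; rewrite -normr_le0 -h norm_enorm. Qed.

Lemma open_eball A : (forall x, A x -> exists2 r, 0 < r & eball x r `<=` A) -> open A.
Proof.
move=> h; rewrite openE => x /h [r r0 rA]; apply/nbhs_ballP.
exists (r / n.+1%:R) => [/=|y]; first by rewrite divr_gt0.
rewrite mx_norm_ball /ball_ /= => xy; apply: rA; rewrite /eball /=.
rewrite enormB (le_lt_trans (enorm_sum_norm _)) //.
apply: (@le_lt_trans _ _ (n.+1%:R * `|x - y|)).
  by rewrite ler_wpM2r // ler_nat.
by rewrite mulrC -ltr_pdivlMr.
Qed.

Lemma open_has_eball A x : open A -> A x -> exists2 r, 0 < r & eball x r `<=` A.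
Proof.
rewrite openE => Ao /Ao /nbhs_ballP [r /= r0 rA]; exists r => // y.
rewrite /eball /= => yx; apply: rA; rewrite mx_norm_ball /ball_ /=.
by rewrite (le_lt_trans (norm_enorm _)) // enormB.
Qed.

Lemma eball_open x r : open (eball x r).
Proof.
apply: open_eball => y; rewrite /eball /= => yx.
exists (r - enorm (y - x)); first by rewrite subr_gt0.
move=> z; rewrite /eball /= ltrBrDr; apply: le_lt_trans.
exact: enorm_dist_triangle.
Qed.

Lemma closure_has_eball A x :
  closure A x <-> forall r, 0 < r -> exists2 y, A y & enorm (y - x) < r.
Proof.
split=> [cA r r0|h].
  have xr : eball x r x by rewrite /eball /= subrr enorm0.
  have [|y [Ay yx]] := cA (eball x r); last by exists y.
  by apply: open_nbhs_nbhs; split=> //; exact: eball_open.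
move=> B; rewrite nbhsE => -[U [Uo Ux] UB].
have [r r0 rU] := open_has_eball Uo Ux.
have [y Ay yx] := h r r0.
by exists y; split=> //; apply/UB/rU.
Qed.

Lemma lip_continuous (f : V -> R) (L : R) :
  (forall x y, `|f x - f y| <= L * enorm (x - y)) -> continuous f.
Proof.
move=> fL x; apply/(@cvgrPdist_lt _ _ _ (nbhs x) (nbhs_filter x)) => e e0.
have M0 : 0 < `|L| + 1 by rewrite ltr_wpDl.
have near_x : nbhs x (eball x (e / (`|L| + 1))).
  apply: open_nbhs_nbhs; split; first exact: eball_open.
  by rewrite /eball /= subrr enorm0 divr_gt0.
apply: (@filterS _ _ (nbhs_filter x) _ _ _ near_x) => y; rewrite /eball /= ltr_pdivlMr // => yx.
apply: le_lt_trans (fL x y) _; rewrite enormB mulrC; apply: le_lt_trans yx.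
by rewrite ler_wpM2l ?enorm_ge0 // (le_trans (ler_norm _)) // lerDl.
Qed.

Lemma closed_sublevel (f : V -> R) r : continuous f -> closed [set x | f x <= r].
Proof.
move=> fc; rewrite (_ : [set x | _] = f @^-1` [set y | y <= r]) //.
by apply: preimage_closed; [move=> ? _; exact: fc|exact: closed_le].
Qed.

Lemma enorm_compact A r (f : V -> R) : A !=set0 -> closed A ->
    (forall x, A x -> enorm x <= r) -> continuous f ->
  exists2 t, A t & forall s, A s -> f t <= f s.
Proof.
move=> A0 Acl Ar fc.
have Ac : compact A.
  apply: bounded_closed_compact => //; exists r; split; first exact: num_real.
  by move=> M rM x Ax /=; rewrite (le_trans (norm_enorm x)) // (le_trans (Ar x Ax)) // ltW.
have [|c cA cm] := @compact_EVT_min _ _ f A A0 Ac.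
  exact: continuous_subspaceT.
by exists c; [rewrite inE in cA|move=> s As; apply: cm; rewrite inE].
Qed.

(** A point [a] of the ball is a convex combination of two points of [A]: a point [b] close to a
    point slightly beyond [a] on the ray from some [c] in [A], and a point [o'] still in a ball
    around [c] inside [A]. *)
Lemma eball_closure A x r : Defs.convex_set A -> open A ->
  eball x r `<=` closure A -> eball x r `<=` A.
Proof.
move=> Ac Ao rA a ar; have [e e0 ea] := open_has_eball (@eball_open x r) ar.
have [c oA _] := (closure_has_eball A a).1 (rA a ar) 1 ltr01.
have [d d0 dA] := open_has_eball Ao oA.
pose k := e / (enorm (a - c) + 1) / 2.
have nao : 0 < enorm (a - c) + 1 by rewrite ltr_wpDl ?enorm_ge0.
have k0 : 0 < k by rewrite !divr_gt0.
have : closure A (a + k *: (a - c)).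
  apply/rA/ea; rewrite /eball /= addrC addKr enormZ gtr0_norm //.
  rewrite /k mulrAC ltr_pdivrMr // mulrAC -mulrA ltr_pM2l //.
  by rewrite ltr_pdivrMr // ; have := enorm_ge0 (a - c); lra.
case/closure_has_eball/(_ (d * k)) => [|b Ab bk]; first exact: mulr_gt0.
pose o' := c + k^-1 *: (a + k *: (a - c) - b).
have Ao2 : A o'.
  apply: dA; rewrite /eball /= /o' addrC addKr enormZ gtr0_norm ?invr_gt0 //.
  by rewrite mulrC ltr_pdivrMr // enormB.
have k1 : 0 < 1 + k by rewrite addr_gt0.
have <- : (1 + k)^-1 *: b + (1 - (1 + k)^-1) *: o' = a.
  by apply/rowP => i; rewrite !mxE; field; rewrite !gt_eqF.
apply: (Ac b o' _ Ab Ao2); first by rewrite invr_ge0 ltW.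
by rewrite invf_le1 // lerDl ltW.
Qed.

End Euclid.

(** * Subgradients and the Legendre transform *)

Section Convex.
Variables (R : realType) (n : nat).
Local Notation V := 'rV[R]_n.
Implicit Types (f : V -> R) (x y z p : V).

Lemma dot_delta x (i : 'I_n) : dot x (delta_mx ord0 i) = x ord0 i.
Proof.
rewrite /dot (bigD1 i) //= big1 ?addr0 => [|j ji]; first by rewrite mxE !eqxx mulr1.
by rewrite mxE (negPf ji) andbF mulr0.
Qed.

(* Hahn-Banach, one coordinate at a time *)
Lemma subdiff_exists f x : convex_fun f -> exists p, subdiff f x p.
Proof.
move=> fc; pose g (h : V) := f (x + h) - f x.
pose U (k : nat) (h : V) := forall i : 'I_n, (k <= i)%N -> h ord0 i = 0.
suff [p pP] : exists p, forall h, U n h -> dot p h <= g h.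
  exists p => z; have := pP (z - x); rewrite /g [x + _]addrC subrK => h.
  by rewrite addrC -lerBrDr h // => i; rewrite leqNgt ltn_ord.
suff H k : (k <= n)%N -> exists p, forall h, U k h -> dot p h <= g h by exact: H.
elim: k => [_|k IH kn].
  exists 0 => h h0; have -> : h = 0 by apply/rowP => i; rewrite h0 // mxE.
  by rewrite dot0r /g addr0 subrr.
have [p pP] := IH (ltnW kn); pose i0 := Ordinal kn; pose e : V := delta_mx ord0 i0.
(* The slope along [e] has to lie above the quotients in [A] and below the forward quotients; by
   [key] the former never exceed the latter, so [sup A] will do. *)
pose A := [set r | exists (h : V) s, [/\ U k h, 0 < s & r = (dot p h - g (h - s *: e)) / s]].
have key h h' s t : U k h -> U k h' -> 0 < s -> 0 < t ->
    (dot p h - g (h - s *: e)) / s <= (g (h' + t *: e) - dot p h') / t.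
  move=> Uh Uh' s0 t0; rewrite ler_pdivrMr // mulrAC ler_pdivlMr //.
  have st : 0 < s + t by rewrite addr_gt0.
  (* With this weight the multiples of [e] cancel in the convex combination. *)
  pose c := t / (s + t).
  have sE : s / (s + t) = 1 - c by rewrite /c; field; rewrite gt_eqF.
  have := pP (c *: h + (1 - c) *: h'); rewrite /g !dotE => h1.
  have /h1 {}h1 : forall i : 'I_n, (k <= i)%N -> (c *: h + (1 - c) *: h') ord0 i = 0.
    by move=> i ki; rewrite !mxE Uh // Uh' // !mulr0 addr0.
  have c0 : 0 <= c by rewrite divr_ge0 ?ltW.
  have c1 : c <= 1 by rewrite ler_pdivrMr // mul1r lerDr ltW.
  have := fc (x + (h - s *: e)) (x + (h' + t *: e)) c c0 c1.
  have -> : c *: (x + (h - s *: e)) + (1 - c) *: (x + (h' + t *: e)) =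
      x + (c *: h + (1 - c) *: h').
    apply/rowP => i; rewrite !mxE /c; field; exact: lt0r_neq0.
  move=> h2.
  have {h1 h2} : c * dot p h + (1 - c) * dot p h' <=
    c * f (x + (h - s *: e)) + (1 - c) * f (x + (h' + t *: e)) - f x by lra.
  rewrite -sE /c -(ler_pM2r st).
  have -> : (t / (s + t) * dot p h + s / (s + t) * dot p h') * (s + t) =
    t * dot p h + s * dot p h' by field; exact: lt0r_neq0.
  have -> : (t / (s + t) * f (x + (h - s *: e)) + s / (s + t) * f (x + (h' + t *: e)) - f x) *
      (s + t) =
    t * f (x + (h - s *: e)) + s * f (x + (h' + t *: e)) - f x * (s + t) by field; exact: lt0r_neq0.
  lra.
have U0 : U k 0 by move=> i _; rewrite mxE.
have Aub h t : U k h -> 0 < t -> ubound A ((g (h + t *: e) - dot p h) / t).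
  by move=> Uh t0 _ [h' [s [Uh' s0 ->]]]; exact: key.
have hsA : has_sup A.
  split; last by eexists; apply: (Aub 0 1).
  by eexists; exists 0, 1; split.
pose a := sup A.
exists (p + (a - p ord0 i0) *: e) => h Uh.
pose t := h ord0 i0; pose h0 := h - t *: e.
have hE : h = h0 + t *: e by rewrite /h0 subrK.
have Uh0 : U k h0.
  move=> i ki; rewrite !mxE eqxx /=; case: eqP => [->|ik]; first by rewrite mulr1 subrr.
  rewrite mulr0 subr0; apply: Uh; rewrite ltn_neqAle ki andbT; apply/eqP => ki'.
  by apply: ik; apply: val_inj.
have -> : dot (p + (a - p ord0 i0) *: e) h = dot p h0 + a * t.
  by rewrite /h0 !dotE !(dotC e) !dot_delta -/t; ring.
have [t0|t0|t0] := ltgtP t 0.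
- have : (dot p h0 - g (h0 - (- t) *: e)) / (- t) <= a.
    apply: ub_le_sup; first exact: hsA.2.
    by exists h0, (- t); split=> //; rewrite oppr_gt0.
  rewrite ler_pdivrMr ?oppr_gt0 // scaleNr opprK -hE; lra.
- have : a <= (g (h0 + t *: e) - dot p h0) / t.
    by apply: ge_sup; [exact: hsA.1|exact: Aub].
  rewrite ler_pdivlMr // -hE; lra.
- by rewrite hE t0 mulr0 scale0r !addr0 pP.
Qed.

Lemma subdiff_lip f (L : R) : convex_fun f ->
  (forall x p, subdiff f x p -> enorm p <= L) ->
  forall x y, `|f x - f y| <= L * enorm (x - y).
Proof.
move=> fc fL.
have h x y : f x - f y <= L * enorm (x - y).
  have [p px] := subdiff_exists x fc.
  have := px y; have := dot_enorm p (x - y); have := fL _ _ px.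
  move=> /(ler_wpM2r (enorm_ge0 (x - y))); rewrite -(opprB x y) dotNr; lra.
by move=> x y; rewrite ler_norml h andbT lerNl opprB enormB h.
Qed.

Lemma segment_value f a b (T : R) : continuous f -> f a <= T -> T <= f b ->
  exists2 t, 0 <= t <= 1 & f (a + t *: (b - a)) = T.
Proof.
move=> fc aT Tb; pose g (t : R) := f (a + t *: (b - a)).
have gc : continuous g.
  move=> t; apply: continuous_comp; last exact: fc.
  apply: continuousD; first exact: cst_continuous.
  exact: scalel_continuous.
have [||t] := @IVT _ g 0 1 T ler01; [exact: continuous_subspaceT| |].
  by rewrite /g scale0r scale1r addr0 addrCA subrr addr0 ge_min aT le_max Tb orbT.
by rewrite in_itv /= => t01 gt; exists t.
Qed.

Lemma convex_fun_seg f a b t : convex_fun f -> 0 <= t -> t <= 1 ->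
  f (a + t *: (b - a)) <= (1 - t) * f a + t * f b.
Proof.
move=> fc t0 t1; have := fc b a t t0 t1; rewrite [leRHS]addrC.
suff -> : a + t *: (b - a) = t *: b + (1 - t) *: a by [].
by apply/rowP => i; rewrite !mxE; ring.
Qed.

Lemma legendre_subdiff f x p : subdiff f x p -> legendre f p = (dot x p - f x)%:E.
Proof.
move=> px; apply/eqP; rewrite eq_le; apply/andP; split.
  apply: ge_ereal_sup => _ [z _ <-]; rewrite lee_fin.
  by have := px z; rewrite !dotE !(dotC p); lra.
by apply: ereal_sup_ubound; exists x.
Qed.

(** Testing the inequality at a subgradient [p] of [f] at [x], where the transform is explicit,
    gives [legendre f z <= dot x z - f x]. *)
Lemma esubdiff_legendre f z x : convex_fun f ->
  esubdiff (legendre f) z x -> subdiff f x z.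
Proof.
move=> fc [zfin /= zx]; have [p px] := subdiff_exists x fc.
have := zx p; rewrite (legendre_subdiff px) => h y.
have : ((dot y z - f y)%:E <= legendre f z)%E by apply: ereal_sup_ubound; exists y.
move: h zfin; case: (legendre f z) => // r; rewrite !lee_fin !dotE => h1 _ h2.
by rewrite !(dotC z); lra.
Qed.

End Convex.

Lemma omega_gt0 (R : realType) k : 0 < omega R k.
Proof.
suff : 0 < omega R k /\ 0 < omega R k.+1 by case.
elim: k => [|k [h0 h1]]; first by split=> /=; rewrite ltr01 || rewrite ltr0n.
by split=> //=; rewrite mulr_gt0 // divr_gt0 // mulr_gt0 // pi_gt0.
Qed.

(** * Separated families, coverings by balls and their measures *)

Section Packing.
Variables (R : realType) (n : nat).
Local Notation V := 'rV[R]_n.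
Implicit Types (P : set V) (l : seq V) (r : R).

Definition separated r l := pairwise (fun a b : V => r <= enorm (a - b)) l.

Definition balls r l : set V := [set z | exists2 a, a \in l & eball a r z].

Lemma balls_nil r : balls r [::] = set0.
Proof. by apply/seteqP; split=> z // [a]. Qed.

Lemma balls_cons r a l : balls r (a :: l) = eball a r `|` balls r l.
Proof.
apply/seteqP; split=> z.
  by move=> [b]; rewrite inE => /predU1P[->|bl] bz; [left|right; exists b].
by case=> [az|[b bl bz]]; [exists a; rewrite ?mem_head|exists b; rewrite // inE bl orbT].
Qed.

(** If there were no such list, a separated list could always be prolonged by an uncovered point, up
    to length [N + 1]. *)
Lemma packing_cover P r (N : nat) :
    (forall l, (forall a, a \in l -> P a) -> separated r l -> (size l <= N)%N) ->
  exists l, [/\ forall a, a \in l -> P a, (size l <= N)%N & P `<=` balls r l].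
Proof.
move=> h; apply: contrapT => H.
suff [l [lP ls lN]] : exists l, [/\ forall a, a \in l -> P a, separated r l & size l = N.+1].
  by have := h l lP ls; rewrite lN ltnn.
elim: N.+1 => [|k [l [lP ls lk]]]; first by exists [::].
have [z Pz zl] : exists2 z, P z & ~ balls r l z.
  apply: contrapT => nz; apply: H; exists l; split=> //; first exact: h.
  by move=> z Pz; apply: contrapT => zl; apply: nz; exists z.
exists (z :: l); split; rewrite /= ?lk //.
  by move=> a; rewrite inE => /predU1P[->//|]; exact: lP.
rewrite /separated /= -/(separated r l) ls andbT; apply/allP => a al.
by rewrite leNgt; apply/negP => za; apply: zl; exists a.
Qed.

Lemma packing_max P r (N : nat) :
    (forall l, (forall a, a \in l -> P a) -> separated r l -> (size l <= N)%N) ->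
  exists l, [/\ forall a, a \in l -> P a, separated r l &
    forall l', (forall a, a \in l' -> P a) -> separated r l' -> (size l' <= size l)%N].
Proof.
move=> h; pose Q k := `[< exists l, [/\ forall a, a \in l -> P a, separated r l & size l = k] >].
have [||k /asboolP[l [lP ls lk]] kmax] := @ex_maxnP Q N.
- by exists 0; apply/asboolP; exists [::].
- by move=> k /asboolP[l [lP ls <-]]; exact: h.
exists l; split=> // l' lP' ls'; rewrite lk; apply: kmax.
by apply/asboolP; exists l'.
Qed.

Lemma separated_map r s (f : V -> V) l :
    (forall a b, r <= enorm (a - b) -> s <= enorm (f a - f b)) ->
  separated r l -> separated s (map f l).
Proof. by move=> h; rewrite /separated pairwise_map; apply: sub_pairwise. Qed.

Lemma measurable_eball a r : measurable (eball a r : set (borelV R n)).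
Proof. by apply: sub_sigma_algebra; exact: eball_open. Qed.

Lemma measurable_closed (A : set V) : closed A -> measurable (A : set (borelV R n)).
Proof.
move=> Acl; rewrite -(setCK A); apply: (@measurableC _ (borelV R n)).
by apply: sub_sigma_algebra; rewrite openC.
Qed.

Lemma measurable_balls r l : measurable (balls r l : set (borelV R n)).
Proof.
elim: l => [|a l IH]; first by rewrite balls_nil; exact: measurable0.
by rewrite balls_cons; apply: (@measurableU _ (borelV R n)) => //; exact: measurable_eball.
Qed.

Lemma balls_ge (mu : probability (borelV R n) R) r b l : separated (2 * r) l ->
  (forall a, a \in l -> (b%:E <= mu (eball a r))%E) ->
  (((size l)%:R * b)%:E <= mu (balls r l))%E.
Proof.
elim: l => [|a l IH] /=; first by rewrite mul0r measure_ge0.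
move=> /andP[al ls] h.
have -> : (mu (balls r (a :: l)) = mu (eball a r) + mu (balls r l))%E.
  rewrite balls_cons measureU //; first exact: measurable_eball.
    exact: measurable_balls.
  apply/seteqP; split=> z // -[az [c cl cz]].
  move/allP: al => /(_ _ cl); rewrite leNgt => /negP; apply.
  apply: le_lt_trans (enorm_dist_triangle z _ _) _.
  by move: az cz; rewrite /eball /= (enormB z a); lra.
rewrite -natr1 mulrDl mul1r EFinD addeC leeD ?h ?mem_head //.
by apply: IH => // c cl; apply: h; rewrite inE cl orbT.
Qed.

Lemma balls_le (mu : probability (borelV R n) R) r b l :
  (forall a, a \in l -> (mu (eball a r) <= b%:E)%E) ->
  (mu (balls r l) <= ((size l)%:R * b)%:E)%E.
Proof.
elim: l => [|a l IH] h; first by rewrite balls_nil measure0 mul0r.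
rewrite balls_cons (le_trans (measureU2 _ _ _)) //.
- exact: measurable_eball.
- exact: measurable_balls.
rewrite -natr1 mulrDl mul1r EFinD addeC leeD ?h ?mem_head //.
by apply: IH => // c cl; apply: h; rewrite inE cl orbT.
Qed.

Lemma mstar_le (mu : probability (borelV R n) R) (A B : set V) :
  measurable (B : set (borelV R n)) -> A `<=` B -> (mstar mu A <= mu B)%E.
Proof. by move=> mB AB; apply: ereal_inf_lbound; exists B. Qed.

End Packing.

(** * Approximate centres of symmetry of convex bodies *)

Section Center.
Variables (R : realType) (n : nat).
Local Notation V := 'rV[R]_n.

Lemma dot_sumr (I : finType) (w : V) (mu : I -> R) (s : I -> V) :
  dot w (\sum_i mu i *: s i) = \sum_i mu i * dot w (s i).
Proof.
elim/big_rec2 : _ => [|i a b _ IH]; first by rewrite dot0r.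
by rewrite dotDr dotZr IH.
Qed.

Lemma convex_jensen (f : V -> R) (I : finType) (mu : I -> R) (s : I -> V) (T : R) :
  convex_fun f -> (forall i, 0 <= mu i) -> \sum_i mu i = 1 ->
  (forall i, f (s i) <= T) -> f (\sum_i mu i *: s i) <= T.
Proof.
move=> fc mu0 mu1 fT; set b := \sum_i _.
have [w wb] := subdiff_exists b fc.
have : \sum_i mu i * (f b + dot w (s i - b)) <= \sum_i mu i * T.
  by apply: ler_sum => i _; rewrite ler_wpM2l // (le_trans (wb (s i))).
rewrite -mulr_suml mu1 mul1r.
rewrite (eq_bigr (fun i => mu i * (f b - dot w b) + mu i * dot w (s i))); last first.
  by move=> i _; rewrite dotBr; ring.
by rewrite big_split /= -mulr_suml mu1 mul1r -dot_sumr -/b subrK.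
Qed.

(** Its determinant is, up to sign, [n!] times the volume of the simplex with vertices [s i]; a row
    of barycentric coordinates of [y] times this matrix is the row [(1, y)]. *)
Definition simplex_mx (s : 'I_(1 + n) -> V) : 'M[R]_(1 + n) :=
  \matrix_(i, j) row_mx 1%:M (s i) ord0 j.

Lemma row_mx_simplex (s : 'I_(1 + n) -> V) (mu : 'rV[R]_(1 + n)) :
  mu *m simplex_mx s = row_mx (\sum_i mu ord0 i)%:M (\sum_i mu ord0 i *: s i).
Proof.
apply/rowP => j; rewrite mxE; case: (split_ordP j) => k ->.
  rewrite row_mxEl ord1 !mxE eqxx mulr1n; apply: eq_bigr => i _.
  by rewrite mxE row_mxEl mxE eqxx mulr1.
rewrite row_mxEr summxE; apply: eq_bigr => i _.
by rewrite mxE row_mxEr mxE.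
Qed.

Lemma det_le (m : nat) (A : 'M[R]_m) (B : R) : (forall i j, `|A i j| <= B) ->
  `|\det A| <= \sum_(s : 'S_m) \prod_(i : 'I_m) B.
Proof.
move=> AB; apply: le_trans (ler_norm_sum _ _ _) _; apply: ler_sum => s _.
rewrite normrM normr_sign mul1r normr_prod; apply: ler_prod => i _.
by rewrite normr_ge0 AB.
Qed.

(** With [a] this number, the reflected point has barycentric coordinates [(1 + a) / (n + 1) - a t]
    with [t <= 2]; they are nonnegative because [1 / (n + 1) = 2 a]. *)
Definition center_ratio : R := (2 * n.+1%:R)^-1.

Lemma center_ratio_gt0 : 0 < center_ratio.
Proof. by rewrite invr_gt0 mulr_gt0. Qed.

Lemma center_ratio_le : center_ratio <= 2^-1.
Proof. by rewrite lef_pV2 ?posrE ?mulr_gt0 // ler_pMr // ler1n. Qed.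

(* [c] is the centroid of a simplex with vertices in the sublevel set and nearly maximal volume: by
   Cramer's rule the barycentric coordinates of the points of the set are at most 2. *)
Lemma center_exists (f : V -> R) (T B r : R) (x : V) :
  convex_fun f -> (forall s, f s <= T -> enorm s <= B) ->
  0 < r -> (forall s, enorm (s - x) <= r -> f s <= T) ->
  exists c, forall s, f s <= T -> f (c - center_ratio *: (s - c)) <= T.
Proof.
move=> fc fB r0 xr.
pose X := [set t : R | exists2 s : 'I_(1 + n) -> V,
   (forall i, f (s i) <= T) & t = `|\det (simplex_mx s)|].
pose e (i : 'I_(1 + n)) : V := if fintype.split i is inr k then x + r *: delta_mx ord0 k else x.
have eT i : f (e i) <= T.
  apply: xr; rewrite /e; case: (fintype.split i) => k; first by rewrite subrr enorm0 ltW.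
  rewrite addrC addKr enormZ gtr0_norm // -[leRHS]mulr1 ler_pM2l //.
  by rewrite /enorm dot_delta mxE !eqxx sqrtr1.
have Xub : ubound X (\sum_(s : 'S_(1 + n)) \prod_(i : 'I_(1 + n)) (1 + `|B|)).
  move=> _ [s sT ->]; apply: det_le => i j; rewrite mxE; case: (split_ordP j) => k ->.
    by rewrite row_mxEl (ord1 k) mxE eqxx normr1 lerDl.
  rewrite row_mxEr (@le_trans _ _ B) //; last by rewrite (le_trans (ler_norm B)) // lerDr.
  rewrite (le_trans _ (fB _ (sT i))) // (le_trans _ (norm_enorm _)) //.
  rewrite [leRHS]/Num.norm /= mx_normrE.
  by apply: (le_bigmax_cond _ (fun j => `|s i j.1 j.2|) (j := (ord0, k))).
have Xe : X `|\det (simplex_mx e)| by exists e.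
have Xs : has_sup X by split; [eexists; exact: Xe|eexists; exact: Xub].
have de : 0 < `|\det (simplex_mx e)|.
  rewrite normr_gt0; apply/negP => /det0P[v v0]; rewrite row_mx_simplex.
  rewrite -row_mx0 => /eq_row_mx[].
  move=> /matrixP/(_ ord0 ord0); rewrite !mxE eqxx mulr1n => v1.
  have -> : \sum_i v ord0 i *: e i = \sum_i v ord0 i *: x +
      \sum_(k < n) (v ord0 (rshift 1 k) * r) *: delta_mx ord0 k.
    rewrite big_split_ord [in RHS]big_split_ord /= -addrA -big_split /=; congr (_ + _).
      apply: eq_bigr => i _; rewrite /e; case: splitP => [j _//|j /= ij].
      by have := ltn_ord i; rewrite {1}ij.
    apply: eq_bigr => i _; rewrite /e; case: splitP => [j /= ij|j /= ij].
      by have := ltn_ord j; rewrite -ij.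
    have -> : i = j by apply: val_inj; move/eqP: ij; rewrite eqn_add2l => /eqP.
    by rewrite scalerDr scalerA.
  rewrite -scaler_suml v1 scale0r add0r => /rowP vk.
  move/eqP: v0; apply; apply/rowP => j; rewrite mxE.
  have vr k : v ord0 (rshift 1 k) = 0.
    have := vk k; rewrite summxE (bigD1 k) //= big1 ?addr0 => [|i ik].
      rewrite !mxE !eqxx mulr1 => /eqP; rewrite mulf_eq0 (gt_eqF r0) orbF.
      by move/eqP.
    by rewrite !mxE (eq_sym k) (negPf ik) andbF mulr0.
  case: (split_ordP j) => k ->; last exact: vr.
  move: v1; rewrite big_split_ord /= big_ord1 (ord1 k) => <-.
  by rewrite big1 ?addr0 // => i _; rewrite vr.
pose D := sup X.
have D0 : 0 < D by apply: lt_le_trans de _; apply: ub_le_sup => //; exact: Xs.2.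
(* A simplex with more than half of the supremal volume; the factor lost here is the bound 2 on the
   coordinates. *)
have [_ [s sT ->] sD] : exists2 t, X t & D - D / 2 < t.
  by apply: sup_adherent; rewrite // divr_gt0.
pose A := simplex_mx s; rewrite -/A in sD.
have dA : 0 < `|\det A| by apply: lt_trans sD; lra.
have nE : n.+1%:R = (2 * center_ratio)^-1 :> R.
  by rewrite /center_ratio invfM invrK mulKf.
pose c := \sum_i (n.+1%:R)^-1 *: s i.
exists c => y yT.
pose lam := row_mx 1%:M y *m invmx A.
have lamA : lam *m A = row_mx 1%:M y.
  by rewrite mulmxKV // unitmxE unitfE -normr_gt0.
have lam2 i : lam ord0 i <= 2.
  pose s' k := if k == i then y else s k.
  have s'T k : f (s' k) <= T by rewrite /s'; case: ifP.
  have dE : \det (simplex_mx s') = lam ord0 i * \det A.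
    rewrite (expand_det_row _ i).
    transitivity ((lam *m A *m \adj A) ord0 i).
      rewrite lamA mxE; apply: eq_bigr => j _; rewrite mxE /s' eqxx; congr (_ * _).
      rewrite [in RHS]mxE; congr (_ * \det _); apply/matrixP => a b.
      by rewrite !mxE eq_sym (negPf (neq_lift _ _)).
    by rewrite -mulmxA mul_mx_adj mul_mx_scalar mxE mulrC.
  have : `|\det (simplex_mx s')| <= D by apply: ub_le_sup; [exact: Xs.2|exists s'].
  rewrite dE normrM => h; have h2 : `|lam ord0 i| * `|\det A| <= 2 * `|\det A| by lra.
  by rewrite (le_trans (ler_norm _)) // -(ler_pM2r dA).
move: lamA; rewrite row_mx_simplex => /eq_row_mx[] /matrixP/(_ ord0 ord0).
rewrite !mxE eqxx !mulr1n => lam1 lamy.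
pose a := center_ratio; have a0 : 0 < a := center_ratio_gt0.
have -> : c - a *: (y - c) = \sum_i ((1 + a) * (n.+1%:R)^-1 - a * lam ord0 i) *: s i.
  rewrite (eq_bigr (fun i => (1 + a) *: ((n.+1%:R)^-1 *: s i) -
    a *: (lam ord0 i *: s i))); last first.
    by move=> i _; rewrite !scalerA scalerBl.
  rewrite big_split /= sumrN.
  have <- : (1 + a) *: c = \sum_(i < 1 + n) (1 + a) *: (n.+1%:R^-1 *: s i).
    by rewrite scaler_sumr.
  have <- : a *: y = \sum_(i < 1 + n) a *: (lam ord0 i *: s i).
    by rewrite -lamy scaler_sumr.
  by apply/rowP => i; rewrite !mxE; ring.
apply: convex_jensen => //.
  move=> i; rewrite subr_ge0 nE invrK -/a.
  have := lam2 i; move=> /(ler_wpM2l (ltW a0)) h; apply: le_trans h _; nra.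
rewrite big_split /= sumrN sumr_const card_ord -mulr_sumr lam1 add1n.
by rewrite -[X in X - _]mulr_natr mulfVK ?pnatr_eq0 // mulr1 addrK.
Qed.

End Center.

(** * Sections as sublevel sets of the gap, and the slopes attained in them *)

Definition gap (R : realType) (n : nat) (psi : 'rV[R]_n -> R) (x p s : 'rV[R]_n) : R :=
  psi s - psi x - dot p (s - x).

Section Gap.
Variables (R : realType) (n : nat) (psi : 'rV[R]_n -> R).
Hypotheses (psic : convex_fun psi) (psi_cont : continuous psi).
Local Notation V := 'rV[R]_n.
Implicit Types (x p s z w t b : V) (T : R).

Lemma gapxx x p : gap psi x p x = 0.
Proof. by rewrite /gap !subrr dot0r subr0. Qed.

Lemma sectionE x p T s : section psi x p T s <-> gap psi x p s <= T.
Proof. by rewrite /section /gap /=; split; lra. Qed.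

Lemma gap_ge0 x p s : subdiff psi x p -> 0 <= gap psi x p s.
Proof. by move=> /(_ s); rewrite /gap; lra. Qed.

Lemma gap_convex x p : convex_fun (gap psi x p).
Proof.
move=> a b t t0 t1; have := psic a b t0 t1; rewrite /gap !dotE; lra.
Qed.

Lemma gap_continuous x p : continuous (gap psi x p).
Proof.
move=> s; apply: (@continuousB _ _ _ (fun s => psi s - psi x) (fun s => dot p (s - x))).
  by apply: (@continuousB _ _ _ psi (fun=> psi x)); [exact: psi_cont|exact: cst_continuous].
apply: (@lip_continuous _ _ (fun s => dot p (s - x)) (enorm p)) => a b.
have -> : dot p (a - x) - dot p (b - x) = dot p (a - b) by rewrite !dotE; ring.
rewrite ler_norml dot_enorm andbT lerNl -dotNr.
by rewrite (le_trans (dot_enorm _ _)) // enormN.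
Qed.

Lemma measurable_section x p T :
  measurable ([set s | gap psi x p s <= T] : set (borelV R n)).
Proof.
by apply: measurable_closed; apply: closed_sublevel; exact: gap_continuous.
Qed.

Lemma gap_subdiff x p z w s :
  subdiff psi z (p + w) -> gap psi x p z + dot w (s - z) <= gap psi x p s.
Proof. by move=> /(_ s); rewrite /gap !dotE; lra. Qed.

Lemma gap_seg x p a (t0 : R) : subdiff psi x p -> 0 <= t0 <= 1 ->
  gap psi x p (x + t0 *: (a - x)) <= t0 * gap psi x p a.
Proof.
move=> px /andP[t00 t01]; have := convex_fun_seg x a (@gap_convex x p) t00 t01.
by rewrite gapxx mulr0 add0r.
Qed.

(** Compare at the point where the segment from [z0] to [s] crosses the level [T]: by convexity the
    gap has grown there by at most the fraction [t] of its full increment, while the linear term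
    scales exactly by [t]. *)
Lemma outside_section x p T z0 w s :
  gap psi x p z0 < T ->
  (forall s, gap psi x p s <= T -> dot w (s - z0) < T - gap psi x p z0) ->
  T < gap psi x p s -> dot w (s - z0) < gap psi x p s - gap psi x p z0.
Proof.
move=> z0T wT sT; have [|t /andP[t0 t1] tT] :=
    @segment_value _ _ (gap psi x p) z0 s T (@gap_continuous x p) (ltW z0T).
  exact: ltW.
have := convex_fun_seg z0 s (@gap_convex x p) t0 t1; rewrite tT => h1.
have := wT (z0 + t *: (s - z0)); rewrite tT lexx => /(_ isT).
rewrite [z0 + _]addrC addrK dotZr => h2.
have tp : 0 < t.
  rewrite lt_neqAle t0 andbT eq_sym; apply/eqP => t00; move: tT.
  by rewrite t00 scale0r addr0; lra.
by rewrite -(ltr_pM2l tp); lra.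
Qed.

Lemma slope_in_section x p T z0 w t :
  gap psi x p z0 < T ->
  (forall s, gap psi x p s <= T -> dot w (s - z0) < T - gap psi x p z0) ->
  subdiff psi t (p + w) -> gap psi x p t <= T.
Proof.
move=> z0T wT wt; rewrite leNgt; apply/negP => tT.
have := outside_section z0T wT tT; have := gap_subdiff x z0 wt.
rewrite -(opprB t z0) dotNr; lra.
Qed.

(** Minimise the gap for the slope [p + w] over the compact section; outside the section its values
    exceed the one at [z0], so the minimum is global. *)
Lemma slope_attained x p T B z0 w :
  (forall s, gap psi x p s <= T -> enorm s <= B) ->
  gap psi x p z0 < T ->
  (forall s, gap psi x p s <= T -> dot w (s - z0) < T - gap psi x p z0) ->
  exists2 t, gap psi x p t <= T & subdiff psi t (p + w).
Proof.
move=> SB z0T wT; pose S := [set s | gap psi x p s <= T].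
have Scl : closed S by apply: closed_sublevel; exact: gap_continuous.
have S0 : S !=set0 by exists z0; exact: ltW.
have [|t tS tmin] := enorm_compact S0 Scl SB (f := fun s => gap psi x (p + w) s).
  exact: gap_continuous.
exists t => // s; rewrite -subr_ge0.
suff : gap psi x (p + w) t <= gap psi x (p + w) s by rewrite /gap !dotE; lra.
have [sT|sT] := leP (gap psi x p s) T; first exact: tmin.
apply: le_trans (tmin z0 (ltW z0T)) _.
by have := outside_section z0T wT sT; rewrite /gap !dotE; lra.
Qed.

End Gap.


(** This is [2 (Q + 1)], where [Q] bounds the number of translates of the slope packing. The base
    [1024 / (k^2 a)] is the product of the ratio [8 / k] of radii in the covering of the section and
    the ratio [128 / (k a)] in the covering of the slopes. *)
Definition slope_const (R : realType) (n : nat) (lam Lam k : R) : R :=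
  2 * ((Lam / lam) ^+ 2 * (1024 / (k ^+ 2 * center_ratio R n)) ^+ n + 1).

Lemma count_bound (R : realFieldType) (m s N : nat) (lam Lam b c1 c2 : R) :
  0 < lam -> 0 < b -> (1 <= s)%N -> 0 <= Lam -> 0 <= c1 ->
  (m * s)%:R * (lam * b) <= N%:R * (Lam * (c1 * b)) ->
  N%:R * (lam * b) <= s%:R * (Lam * (c2 * b)) ->
  m%:R <= (Lam / lam) ^+ 2 * (c1 * c2).
Proof.
move=> lam0 b0 s1 Lam0 c10 h1 h2.
have s0 : 0 < s%:R :> R by rewrite ltr0n.
rewrite expr_div_n mulrAC ler_pdivlMr ?exprn_gt0 //.
rewrite -(ler_pM2l (mulr_gt0 s0 b0)).
have {}h1 := ler_wpM2r (ltW lam0) h1.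
have {}h2 := ler_wpM2l (mulr_ge0 Lam0 c10) h2.
by move: h1 h2; rewrite natrM; lra.
Qed.

(** * Growth of the gap and location of the slopes *)

Section Setting.
Variables (R : realType) (n : nat) (Om Oc Om' : set 'rV[R]_n).
Variables (mu nu : probability (borelV R n) R) (delta lam Lam rho D M : R).
Variable psi : 'rV[R]_n -> R.
Local Notation V := 'rV[R]_n.
Hypotheses (OmP : bounded_convex_open Om) (OcP : bounded_convex_open Oc).
Hypotheses (delta0 : 0 < delta) (muA : assumption_A Om Oc mu nu delta lam Lam).
Hypothesis psic : convex_fun psi.
Hypothesis psiO : subdiff_img psi [set: 'rV[R]_n] `<=` closure Oc.
Hypothesis I1 : forall A : set (borelV R n), measurable A -> A `<=` Om ->
  (mu A <= mstar nu (subdiff_img psi A))%E.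
Hypothesis I2 : forall B : set (borelV R n), measurable B -> B `<=` Oc ->
  (nu B <= mstar mu (esubdiff_img (legendre psi) B))%E.
Hypotheses (rho0 : 0 < rho) (Om'o : open Om') (Om'Om : closure Om' `<=` Om).
Hypothesis Om'R : cond_R psi Om Om' rho.
Hypothesis DP : forall a b, Om a -> Om b -> enorm (a - b) < D.
Hypothesis MP : forall a b q r, Om a -> Om b -> subdiff psi a q ->
  subdiff psi b r -> enorm (q - r) <= M.
Hypotheses (D0 : 0 < D) (M0 : 0 < M).

Lemma psi_continuous : continuous psi.
Proof.
have [_ [[B BP] _]] := OcP.
apply: (@lip_continuous _ _ psi (B + 1)); apply: subdiff_lip => // x p px.
have : closure Oc p by apply: psiO; exists x.
case/closure_has_eball/(_ 1 ltr01) => q /BP qB qp.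
have := ler_enormD (p - q) q; rewrite subrK enormB; lra.
Qed.
Let psi_cont := psi_continuous.

Lemma subOm z : Om' z -> Om z.
Proof. by move=> ?; apply/Om'Om/subset_closure. Qed.

Lemma gap_le_slope x p a b : Om x -> subdiff psi x p -> Om b ->
  gap psi x p b - gap psi x p a <= M * enorm (b - a).
Proof.
move=> Ox px Ob; have [q qb] := subdiff_exists b psic.
have : subdiff psi b (p + (q - p)) by rewrite addrC subrK.
move=> /(gap_subdiff x a); have := dot_enorm (q - p) (b - a).
have := MP Ob Ox qb px => /(ler_wpM2r (enorm_ge0 (b - a))).
rewrite -(opprB b a) dotNr; lra.
Qed.

(** As [b] is not known to lie in Omega, the slope bound is applied where the segment from [a] to
    [b] would cross the level [T']; the crossing could only be [b] itself, against
    [T' < gap psi x p b]. *)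
Lemma section_nbhd x p T T' a b : Om x -> subdiff psi x p ->
  section psi x p rho `<=` Om -> T' <= rho ->
  gap psi x p a <= T -> T + M * enorm (b - a) <= T' -> gap psi x p b <= T'.
Proof.
move=> Ox px Sx T'rho aT TT'; rewrite leNgt; apply/negP => bT.
have nba := enorm_ge0 (b - a).
have Mba : 0 <= M * enorm (b - a) by rewrite mulr_ge0 // ltW.
have aT' : gap psi x p a <= T' by lra.
have [|t /andP[t0 t1] tT] := @segment_value _ _ (gap psi x p) a b T'
   (gap_continuous psi_cont (x := x) (p := p)) aT'; first exact: ltW.
have Oc' : Om (a + t *: (b - a)).
  by apply/Sx/sectionE; rewrite tT.
have := gap_le_slope a Ox px Oc'; rewrite tT [a + _]addrC addrK enormZ ger0_norm // => h.
have {}h : M * enorm (b - a) <= t * (M * enorm (b - a)) by lra.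
have [ba|ba] := eqVneq (M * enorm (b - a)) 0.
  have : enorm (b - a) = 0 by apply/eqP; move/eqP: ba; rewrite mulf_eq0 (gt_eqF M0).
  by move/enorm_eq0/eqP; rewrite subr_eq0 => /eqP ab; move: bT; rewrite ab; lra.
have t1' : t = 1.
  apply/eqP; rewrite eq_le t1 /=; move: h.
  by rewrite -{1}[M * _]mul1r ler_pM2r // lt_neqAle eq_sym ba.
by move: tT bT; rewrite t1' scale1r addrC subrK => ->; rewrite ltxx.
Qed.

(** The point of the ray at distance [D] from [z] is outside Omega, hence above the level [rho]; by
    convexity the growth is linear beyond it. *)
Lemma far_gap z p b : Om' z -> subdiff psi z p -> section psi z p rho `<=` Om ->
  D <= enorm (b - z) -> rho / D * enorm (b - z) <= gap psi z p b.
Proof.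
move=> Oz pz Sz Db; have b0 : 0 < enorm (b - z) by exact: lt_le_trans D0 Db.
pose t := D / enorm (b - z).
have t0 : 0 < t by rewrite divr_gt0.
have t1 : t <= 1 by rewrite ler_pdivrMr // mul1r.
have : ~ Om (z + t *: (b - z)).
  move=> /DP /(_ (subOm Oz)); rewrite [z + _]addrC addrK enormZ ger0_norm ?ltW //.
  by rewrite divfK ?gt_eqF // ltxx.
have := gap_seg psic b pz (t0 := t); rewrite (ltW t0) t1 => /(_ isT) h nO.
have : rho < gap psi z p (z + t *: (b - z)).
  rewrite ltNge; apply/negP => h2; apply/nO/Sz.
  exact/sectionE.
move=> h2; have {h h2} : rho < t * gap psi z p b by lra.
rewrite /t mulrAC ltr_pdivlMr // => h.
by rewrite mulrAC ler_pdivrMr // mulrC [leRHS]mulrC mulrC ltW.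
Qed.

(* Apply [far_gap] at points of Om' slightly beyond [z] in the direction of [b]: by monotonicity
   their slopes in that direction are at least that of [w]. *)
Lemma far_gap_subdiff z w b : Om' z -> subdiff psi z w ->
  D < enorm (b - z) -> rho / D * enorm (b - z) <= gap psi z w b.
Proof.
move=> Oz wz Db; rewrite leNgt; apply/negP => hb.
pose L := enorm (b - z); have L0 : 0 < L by exact: lt_trans D0 Db.
have [r r0 rO] := open_has_eball Om'o Oz.
pose E := rho / D * L; have E0 : 0 < E by rewrite mulr_gt0 // divr_gt0.
(* The three bounds keep [z'] in Omega', keep [b] at distance at least [D] from it, and make the
   loss [s * E] at most half of the supposed deficit. *)
pose s := Num.min (r / (2 * L)) (Num.min (1 - D / L) ((E - gap psi z w b) / (2 * E))).
have DL : D / L < 1 by rewrite ltr_pdivrMr // mul1r.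
have s0 : 0 < s.
  rewrite !lt_min; apply/and3P; split; first by rewrite divr_gt0 ?mulr_gt0.
    by rewrite subr_gt0.
  by rewrite divr_gt0 ?subr_gt0 // mulr_gt0.
have s1 : s <= r / (2 * L) by rewrite ge_min lexx.
have s2 : s <= 1 - D / L by rewrite !ge_min lexx orbT.
have s3 : s <= (E - gap psi z w b) / (2 * E) by rewrite !ge_min lexx !orbT.
pose z' := z + s *: (b - z).
have Oz' : Om' z'.
  apply: rO; rewrite /eball /= /z' addrC addKr enormZ gtr0_norm // -/L.
  have := ler_wpM2r (ltW L0) s1.
  have -> : r / (2 * L) * L = r / 2 by field; exact: lt0r_neq0.
  lra.
have [p pz' Sz'] := Om'R Oz'.
have bz' : b - z' = (1 - s) *: (b - z).
  by apply/rowP => i; rewrite !mxE; ring.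
have DLL : D / L * L = D by rewrite divfK ?gt_eqF.
have s21 : s < 1 by have := divr_gt0 D0 L0; lra.
have nbz' : enorm (b - z') = (1 - s) * L.
  by rewrite bz' enormZ gtr0_norm // subr_gt0.
have := far_gap Oz' pz' Sz' (b := b); rewrite nbz'.
have := ler_wpM2r (ltW L0) s2; rewrite mulrBl DLL => h /(_ _).
have -> : (D <= (1 - s) * L) by lra.
move=> /(_ isT); rewrite /gap bz' dotZr => h1.
have h2 := wz z'; have h3 := pz' z; move: h2 h3.
have -> : z' - z = s *: (b - z) by rewrite /z' addrC addKr.
have -> : z - z' = - (s *: (b - z)) by rewrite /z' opprD addNKr.
rewrite dotNr !dotZr => h2 h3.
have h4 : dot w (b - z) <= dot p (b - z) by rewrite -(ler_pM2l s0); lra.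
have h5 : (1 - s) * dot w (b - z) <= (1 - s) * dot p (b - z).
  by rewrite ler_pM2l // subr_gt0.
have h6 : s * (2 * E) <= E - gap psi z w b by rewrite -ler_pdivlMr // mulr_gt0.
have sE := mulr_gt0 s0 E0.
have e1 : rho / D * ((1 - s) * L) = (1 - s) * E by rewrite /E; ring.
by move: h6 h1 hb; rewrite e1 -/L -/E /gap; lra.
Qed.

(** For [q] in this ball the gap with slope [q] is nonnegative at distance more than [D] from [z],
    so it attains its minimum; thus [q] is a slope of [psi], in the closure of the target by (O).
    This makes the upper bound on [nu] available around slopes at points of Omega'. *)
Lemma slope_ball z w : Om' z -> subdiff psi z w -> eball w (rho / D) `<=` Oc.
Proof.
move=> Oz wz; have [Oo [_ Oc_conv]] := OcP.
apply: eball_closure => //; move=> q; rewrite /eball /= => qw.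
pose S := ecball z D.
have Scl : closed S.
  apply: (closed_sublevel (f := fun s => enorm (s - z))).
  apply: (@lip_continuous _ _ (fun s => enorm (s - z)) 1) => c d.
  have := enorm_dist_triangle d c z; have := enorm_dist_triangle c d z.
  by rewrite mul1r ler_norml (enormB d c); lra.
have S0 : S !=set0 by exists z; rewrite /S /ecball /= subrr enorm0 ltW.
have SB s : S s -> enorm s <= D + enorm z.
  by rewrite /S /ecball /=; have := ler_enormD (s - z) z; rewrite subrK; lra.
have [|t tS tmin] := enorm_compact S0 Scl SB (f := fun s => gap psi z q s).
  exact: gap_continuous.
apply: psiO; exists t => // b; rewrite -subr_ge0.
suff : gap psi z q t <= gap psi z q b by rewrite /gap !dotE; lra.
have [bD|bD] := leP (enorm (b - z)) D; first exact: tmin.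
have : gap psi z q t <= 0.
  have := tmin z; rewrite gapxx; apply.
  by rewrite /S /ecball /= subrr enorm0 ltW.
suff : 0 <= gap psi z q b by lra.
have := far_gap_subdiff Oz wz bD; have := dot_enorm (q - w) (b - z).
have := ler_wpM2r (enorm_ge0 (b - z)) (ltW qw).
by rewrite /gap (dotBl q); lra.
Qed.

(** The form in which (I2) is used: slopes in [B] are attained in the section only. *)
Lemma nu_le_mu_section x p T z0 (B : set V) :
  gap psi x p z0 < T ->
  measurable (B : set (borelV R n)) -> B `<=` Oc ->
  (forall q s, B q -> gap psi x p s <= T -> dot (q - p) (s - z0) < T - gap psi x p z0) ->
  (nu B <= mu [set s | (gap psi x p s <= T)%R])%E.
Proof.
move=> z0T mB BO BQ; apply: le_trans (I2 mB BO) _; apply: mstar_le.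
  exact: measurable_section.
move=> t [q Bq /esubdiff_legendre qt] /=.
have {}qt := qt psic.
apply: (slope_in_section psic psi_cont z0T (w := q - p)).
  by move=> s; exact: BQ.
by rewrite addrC subrK.
Qed.


Local Notation a := (center_ratio R n).
Local Notation bv := (ball_vol n : R -> R).

Let a0 : 0 < a := center_ratio_gt0 R n.

Lemma ball_volM c r : bv (c * r) = c ^+ n * bv r.
Proof. by rewrite /ball_vol exprMn; ring. Qed.

Lemma ball_vol_gt0 r : 0 < r -> 0 < bv r.
Proof. by move=> r0; rewrite mulr_gt0 ?omega_gt0 // exprn_gt0. Qed.

(** * Counting the slopes of one section *)

Section Key.
Variables (x p : V) (T : R).
Hypotheses (Oz : Om' x) (px : subdiff psi x p) (Sx : section psi x p rho `<=` Om).
Hypotheses (T0 : 0 < T) (T_rho : T <= rho / 2).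
Local Notation v := (gap psi x p).

Let vc : convex_fun v := @gap_convex R n psi psic x p.

Lemma gap_conv b c (t : R) : v b <= T -> v c <= T -> 0 <= t <= 1 ->
  v (b + t *: (c - b)) <= T.
Proof.
move=> bT cT /andP[t0 t1].
apply: le_trans (convex_fun_seg b c vc t0 t1) _.
have := ler_wpM2l t0 cT; have : 0 <= 1 - t by rewrite subr_ge0.
move/ler_wpM2l => /(_ _ _ bT); lra.
Qed.

Lemma section_dist b c : v b <= T -> v c <= T -> enorm (b - c) < D.
Proof.
have Trho : T <= rho by have := rho0; have := T_rho; lra.
by move=> bT cT; apply: DP; apply/Sx/sectionE; apply: le_trans Trho.
Qed.

(** The ball of radius [T / M] around [x] is in the section; the reflection about [c] and convexity
    carry it, shrunk by [a], to a ball around [c]. *)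
Lemma section_center : exists2 c,
  (forall s, v s <= T -> v (c - a *: (s - c)) <= T) &
  (forall u, M * enorm u <= a * T -> v (c + u) <= T).
Proof.
have Trho : T <= rho by have := rho0; have := T_rho; lra.
have [_ [[B BP] _]] := OmP.
have xr s : enorm (s - x) <= T / M -> v s <= T.
  rewrite ler_pdivlMr // => sx.
  apply: (section_nbhd (subOm Oz) px Sx Trho (a := x) (T := 0)).
    by rewrite gapxx.
  by rewrite add0r mulrC.
have [||c cP] := center_exists vc (T := T) (B := B) _ _ xr.
- by move=> s sT; apply/BP/Sx/sectionE; apply: le_trans Trho.
- by rewrite divr_gt0.
exists c => // u Mu.
(* With this [b], [c + u] lies on the segment from the reflected image of [x - b u] to [x + b u]. *)
pose b := (1 + a) / (2 * a).
have b0 : 0 < b by rewrite divr_gt0 ?mulr_gt0 ?addr_gt0.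
have bu : b * enorm u <= T / M.
  rewrite ler_pdivlMr // -mulrA [enorm u * M]mulrC.
  apply: le_trans (ler_wpM2l (ltW b0) Mu) _.
  have -> : b * (a * T) = (1 + a) / 2 * T by rewrite /b; field; exact: lt0r_neq0.
  rewrite -[leRHS]mul1r ler_pM2r // ; have := center_ratio_le R n; lra.
have s1 : v (x + - b *: u) <= T.
  by apply: xr; rewrite [x + _]addrC addrK enormZ normrN gtr0_norm.
have s2 : v (x + b *: u) <= T.
  by apply: xr; rewrite [x + _]addrC addrK enormZ gtr0_norm.
have := gap_conv (cP _ s1) s2 (t := a / (1 + a)).
have a10 : 0 < 1 + a by rewrite addr_gt0.
set y := (X in v X <= T); have -> : y = c + u.
  rewrite /y /b; apply/rowP => i; rewrite !mxE; field.
  by rewrite !lt0r_neq0.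
apply; apply/andP; split; first by rewrite divr_ge0 // ltW.
by rewrite ler_pdivrMr // mul1r; lra.
Qed.

(* The balls are centred at a maximal [2 delta]-separated family of points
   [(1 - k) x + k (3 c + s) / 4], [s] in the section; enlarged by [8 / k], they would cover it. *)
Lemma section_core k : 0 < k -> k <= 1 -> 4 * M * delta <= k * a * T ->
    16 * M * delta <= k * rho ->
    (forall s, v s <= T -> Om' (x + k *: (s - x))) ->
  exists (l : seq V), [/\ balls delta l `<=` Om',
    (mu [set s | (v s <= T)%R] <= ((size l)%:R * (Lam * bv (8 / k * delta)))%:E)%E,
    (((size l)%:R * (lam * bv delta))%:E <= mu (balls delta l))%E &
    forall z w s s', balls delta l z -> subdiff psi z (p + w) -> v s <= T ->
      v s' <= T -> dot w (s - s') <= 4 * T / (k * a)].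
Proof.
move=> k0 k1 dk drho kO.
have [lam0 [lamLam [muB _]]] := muA.
have [c cP cu] := section_center.
pose g s := x + k *: (c + 4^-1 *: (s - c) - x).
pose P := [set y | exists2 s, v s <= T & y = g s].
have mid b b' : v b <= T -> v b' <= T -> v (2^-1 *: (b + b')) <= T.
  move=> bT b'T; have := gap_conv bT b'T (t := 2^-1).
  have -> : b + 2^-1 *: (b' - b) = 2^-1 *: (b + b').
    by apply/rowP => i; rewrite !mxE; field.
  by apply; lra.
have cT : v c <= T.
  by rewrite -[c]addr0; apply: cu; rewrite enorm0 mulr0 mulr_ge0 // ltW.
have ck u : enorm u < delta -> v (c + (4 / k) *: u) <= T.
  move=> ud; apply: cu; rewrite enormZ gtr0_norm ?divr_gt0 //.
  have -> : M * (4 / k * enorm u) = 4 * M * enorm u / k by field; exact: lt0r_neq0.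
  rewrite ler_pdivrMr //.
  have := ler_wpM2l (ltW M0) (ltW ud); lra.
have core s z : v s <= T -> enorm (z - g s) < delta ->
    (forall s1 s2, v s1 <= T -> v s2 <= T -> v (z + (k * a / 4) *: (s1 - s2)) <= T) /\
    Om' z.
  move=> sT zs.
  have h s1 s2 : v s1 <= T -> v s2 <= T -> exists2 b, v b <= T &
      z + (k * a / 4) *: (s1 - s2) = x + k *: (b - x).
    move=> s1T s2T; pose u := z - g s.
    have a01 : 0 <= a <= 1.
      by rewrite (ltW a0) /=; have := center_ratio_le R n; lra.
    (* The average of [s], a perturbation of [c] that absorbs [u], a contraction of [s1] and a
       reflection of [s2]; this is why [g] gives [s] the weight [1 / 4] only. *)
    exists (2^-1 *: (2^-1 *: (s + (c + (4 / k) *: u)) +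
                     2^-1 *: ((c + a *: (s1 - c)) + (c - a *: (s2 - c))))).
      apply: (mid _ _ (mid _ _ sT (ck _ zs))).
      by apply: (mid _ _ _ (cP _ s2T)); exact: gap_conv.
    rewrite /u /g; apply/rowP => i; rewrite !mxE; field; exact: lt0r_neq0.
  split=> [s1 s2 s1T s2T|].
    have [b bT ->] := h s1 s2 s1T s2T; apply: gap_conv => //; last by rewrite ltW.
    by rewrite gapxx ltW.
  have [b bT] := h c c cT cT.
  by rewrite subrr scaler0 addr0 => ->; exact: kO.
have coreb s : v s <= T -> eball (g s) delta `<=` Om'.
  by move=> sT z zs; have [] := core s z sT zs.
have bound l : (forall y, y \in l -> P y) -> separated (2 * delta) l ->
    (((size l)%:R * (lam * bv delta))%:E <= mu (balls delta l))%E.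
  move=> lP ls; apply: balls_ge => // y /lP [s sT ->].
  by case/andP: (muB (g s) delta (lexx _) (fun z zs => subOm (coreb _ sT z zs))).
pose N := Num.bound (1 / (lam * bv delta)).
have lb0 : 0 < lam * bv delta by rewrite mulr_gt0 // ball_vol_gt0.
have boundN l : (forall y, y \in l -> P y) -> separated (2 * delta) l -> (size l <= N)%N.
  move=> lP ls; have := bound l lP ls.
  have : (mu (balls delta l) <= 1)%E by apply: probability_le1; exact: measurable_balls.
  move=> h1 h2; have := le_trans h2 h1; rewrite lee_fin -ler_pdivlMr // => h3.
  rewrite -(ler_nat R) (le_trans h3) //; apply/ltW/archi_boundP.
  by rewrite divr_ge0 // ltW.
have [l [lP ls lmax]] := packing_max boundN.
have [l' [l'P l'l l'c]] : exists l', [/\ forall b, b \in l' -> v b <= T,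
    (size l' <= size l)%N & [set s | v s <= T] `<=` balls (8 / k * delta) l'].
  apply: packing_cover => l' l'P l's; rewrite -(size_map g).
  apply: lmax.
    by move=> y /mapP[s /l'P sT ->]; exists s.
  apply: separated_map l's => s s' ss'.
  have -> : g s - g s' = (k / 4) *: (s - s').
    by rewrite /g; apply/rowP => i; rewrite !mxE; field.
  rewrite enormZ gtr0_norm ?divr_gt0 //.
  by move: ss'; rewrite mulrAC ler_pdivrMr // => h; lra.
exists l; split.
- by move=> z [y /lP [s sT ->]]; exact: coreb.
- apply: (@le_trans _ _ (mu (balls (8 / k * delta) l'))).
    apply: le_measure => //; rewrite ?inE; last exact: measurable_balls.
    exact: measurable_section.
  have Lb0 : 0 <= Lam * bv (8 / k * delta).
    apply: mulr_ge0; first exact: le_trans (ltW lam0) lamLam.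
    by apply/ltW/ball_vol_gt0; rewrite mulr_gt0 // divr_gt0.
  apply: (@le_trans _ _ ((size l')%:R * (Lam * bv (8 / k * delta)))%:E); last first.
    by rewrite lee_fin ler_wpM2r // ler_nat.
  apply: balls_le => b /l'P bT.
  apply: (fun h1 h2 => proj2 (elimT andP (muB b (8 / k * delta) h1 h2))).
    have k8 : 1 <= 8 / k by rewrite ler_pdivlMr // mul1r; lra.
    by rewrite -[leLHS]mul1r ler_pM2r.
  move=> b'; rewrite /eball /= => b'b; apply/Sx/sectionE.
  apply: (section_nbhd (subOm Oz) px Sx (lexx _) bT).
  have h : M * enorm (b' - b) <= M * (8 / k * delta) by rewrite ler_wpM2l // ltW.
  have : M * (8 / k * delta) * 2 <= rho.
    rewrite (_ : M * _ * 2 = 16 * M * delta / k); last by field; exact: lt0r_neq0.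
    by rewrite ler_pdivrMr //; lra.
  have := T_rho; lra.
- exact: bound.
move=> z w s s' [y /lP [s0 s0T ->] zy] zw sT s'T.
have [h _] := core s0 z s0T zy.
have := gap_subdiff x (z + (k * a / 4) *: (s - s')) zw.
have := h _ _ sT s'T; have := gap_ge0 z px.
rewrite [z + _]addrC addrK dotZr ler_pdivlMr ?mulr_gt0 //; lra.
Qed.


(** Moving a slope of [l] by less than [delta] changes its pairing with [s - z0] by less than
    [delta * D], which is at most an eighth of [T - v z0]. It is then still attained in the section,
    so the balls lie in the target by (O), and (I2) applies to their union. *)
Lemma slope_packing z0 l : v z0 < T -> delta * D <= (T - v z0) / 8 ->
    (forall q s, q \in l -> v s <= T -> dot (q - p) (s - z0) <= (T - v z0) * (7 / 8)) ->
    separated (2 * delta) l ->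
  (((size l)%:R * (lam * bv delta))%:E <= mu [set s | (v s <= T)%R])%E.
Proof.
move=> z0T dD lQ ls.
have [lam0 [lamLam [_ nuB]]] := muA; have [Oo [_ Ocv]] := OcP.
have vcont := gap_continuous psi_cont (x := x) (p := p).
have [_ [[B BP] _]] := OmP.
have Trho : T <= rho by have := rho0; have := T_rho; lra.
have SB s : v s <= T -> enorm s <= B.
  by move=> sT; apply/BP/Sx/sectionE; apply: le_trans Trho.
have slope q b s : q \in l -> enorm (b - q) < delta -> v s <= T ->
    dot (b - p) (s - z0) < T - v z0.
  move=> ql bq sT; have h1 := lQ q s ql sT.
  have h2 := dot_enorm (b - q) (s - z0).
  have h3 : enorm (b - q) * enorm (s - z0) < delta * D.
    rewrite ltr_pM ?enorm_ge0 //; exact: section_dist (ltW z0T).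
  have -> : dot (b - p) (s - z0) = dot (q - p) (s - z0) + dot (b - q) (s - z0).
    by rewrite !dotE; ring.
  lra.
have ballO q : q \in l -> eball q delta `<=` Oc.
  move=> ql; apply: eball_closure => // b bq; apply: psiO.
  have [t _ tb] := slope_attained psic psi_cont SB z0T (fun s => slope q b s ql bq).
  by exists t => //; move: tb; rewrite addrC subrK.
apply: (@le_trans _ _ (nu (balls delta l))).
  apply: balls_ge => // q ql.
  by case/andP: (nuB q delta (lexx _) (ballO q ql)).
apply: (nu_le_mu_section z0T); first exact: measurable_balls.
  by move=> b [q ql]; exact: ballO.
by move=> b s [q ql bq]; exact: (slope q b s ql bq).
Qed.

(** Translated by [- p] and scaled by [k], the slopes over the balls fall into the polar body, whose
    packings have at most [N] points. So [N] balls of radius [2 * delta / k] cover these slopes;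
    they lie in the target by [slope_ball], and (I1) concludes. *)
Lemma slope_cover k (l : seq V) (E : R) (N : nat) : 0 < k -> k <= 1 -> 0 < E ->
    balls delta l `<=` Om' ->
    (forall z w s s', balls delta l z -> subdiff psi z (p + w) -> v s <= T ->
      v s' <= T -> dot w (s - s') <= k^-1 * E) ->
    2 * delta / k <= rho / D ->
    (forall l, (forall w, w \in l -> forall s s', v s <= T -> v s' <= T -> dot w (s - s') <= E) ->
       separated (2 * delta) l -> (size l <= N)%N) ->
  (mu (balls delta l) <= (N%:R * (Lam * bv (2 * delta / k)))%:E)%E.
Proof.
move=> k0 k1 E0 lO lw dk maxN.
have [lam0 [lamLam [_ nuB]]] := muA.
have mA := measurable_balls delta l.
have AO : balls delta l `<=` Om by move=> z /lO/subOm.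
apply: le_trans (I1 mA AO) _.
pose P := subdiff_img psi (balls delta l).
have [l' [l'P l'N l'c]] : exists l', [/\ forall q, q \in l' -> P q,
    (size l' <= N)%N & P `<=` balls (2 * delta / k) l'].
  apply: packing_cover => l' l'P l's.
  rewrite -(size_map (fun q => k *: (q - p))); apply: maxN.
    move=> w /mapP[q /l'P [z zl zq] ->] s s' sT s'T.
    have := lw z (q - p) s s' zl _ sT s'T; rewrite addrC subrK => /(_ zq).
    by rewrite dotZl ler_pdivlMl.
  apply: separated_map l's => q q'.
  have -> : k *: (q - p) - k *: (q' - p) = k *: (q - q').
    by apply/rowP => i; rewrite !mxE; ring.
  by rewrite enormZ gtr0_norm // ler_pdivrMr // [_ * k]mulrC.
apply: (@le_trans _ _ (nu (balls (2 * delta / k) l'))).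
  by apply: mstar_le => //; exact: measurable_balls.
have kd : delta <= 2 * delta / k.
  rewrite ler_pdivlMr //; have := ler_wpM2l (ltW delta0) k1; have := delta0; lra.
have Lb0 : 0 <= Lam * bv (2 * delta / k).
  apply: mulr_ge0; first exact: le_trans (ltW lam0) lamLam.
  by apply/ltW/ball_vol_gt0; exact: lt_le_trans kd.
apply: (@le_trans _ _ ((size l')%:R * (Lam * bv (2 * delta / k)))%:E); last first.
  by rewrite lee_fin ler_wpM2r // ler_nat.
apply: balls_le => q /l'P [z zl zq].
apply: (fun h => proj2 (elimT andP (nuB q (2 * delta / k) kd h))).
move=> b; rewrite /eball /= => bq; apply: (slope_ball (lO z zl) zq).
exact: lt_le_trans bq dk.
Qed.

(** In the direction [d] one shift by [e] exceeds the width [E] of [l] by at least [r0 * enorm d],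
    so points of different translates stay separated by Cauchy-Schwarz. *)
Lemma translates (d e : V) (l : seq V) (r0 E c : R) (m : nat) :
    separated r0 l -> dot e d = c -> 0 <= c -> r0 * enorm d <= c - E -> 0 < enorm d ->
    (forall w w', w \in l -> w' \in l -> dot (w - w') d <= E) ->
  exists L, [/\ separated r0 L, size L = (m * size l)%N &
    forall q, q \in L -> exists2 w, w \in l & exists2 j, (j < m)%N & q = w + j%:R *: e].
Proof.
move=> ls ec c0 rE d0 lE; elim: m => [|m [L [Ls Lsz Lm]]]; first by exists [::].
exists ([seq w + m%:R *: e | w <- l] ++ L); split.
- rewrite /separated pairwise_cat -/(separated r0 L) Ls andbT; apply/andP; split.
    apply/allrelP => q q' /mapP[w wl ->] /Lm [w' w'l [j jm ->]].
    rewrite -(ler_pM2r d0); apply: le_trans (dot_enorm _ _).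
    have -> : dot (w + m%:R *: e - (w' + j%:R *: e)) d =
       (m%:R - j%:R) * c - dot (w' - w) d by rewrite -ec !dotE; ring.
    have h1 := lE _ _ w'l wl; apply: le_trans rE _.
    rewrite -natrB ?(ltnW jm) // lerB // ler_peMl // ler1n subn_gt0 //.
  apply: separated_map ls => w w'.
  by rewrite opprD addrACA subrr addr0.
- by rewrite size_cat size_map Lsz mulSn.
- move=> q; rewrite mem_cat => /orP[/mapP[w wl ->]|/Lm [w wl [j jm ->]]].
    by exists w => //; exists m.
  by exists w => //; exists j => //; exact: ltnW.
Qed.

(* If [h] is the left-hand side, the slopes [p + w + j (T - v z0) / h (q - p)], with [w] in a
   maximal packing of a small polar body and [j <= h / (2 (T - v z0))], are attained in the section
   only. So (I2) bounds [h / T] times the number of the [w] by the mass of the section, which by (I1)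
   is at most a constant times this number. *)
Lemma slope_bound k z0 q : 0 < k -> k <= 1 ->
    (64 * D + 4 * M) / (k * a) * delta <= T ->
    (forall s, v s <= T -> Om' (x + k *: (s - x))) ->
    v z0 <= T / 2 -> subdiff psi z0 q ->
  psi x - psi z0 - dot q (x - z0) <= slope_const n lam Lam k * T.
Proof.
move=> k0 k1 KT kO z0T2 qz0.
have [lam0 [lamLam _]] := muA.
have ka0 : 0 < k * a by rewrite mulr_gt0.
have a2 := center_ratio_le R n.
have ka2 : k * a <= 2^-1 by rewrite (le_trans _ a2) // ler_piMl // ltW.
have {}KT : (64 * D + 4 * M) * delta <= k * a * T.
  by rewrite [leRHS]mulrC -ler_pdivrMr // mulrAC.
have Dd0 := mulr_gt0 D0 delta0; have Md0 := mulr_gt0 M0 delta0.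
have kaT : k * a * T <= 2^-1 * T by rewrite ler_wpM2r // ltW.
have vz0 := gap_ge0 z0 px.
have z0T : v z0 < T by have := T0; lra.
pose E1 := T - v z0; have E10 : 0 < E1 by rewrite subr_gt0.
have E1T : E1 <= T by rewrite /E1; lra.
have E1T2 : T <= 2 * E1 by rewrite /E1; lra.
pose h := psi x - psi z0 - dot q (x - z0); rewrite -/h.
have [Q Q0 QE] : exists2 Q, 0 <= Q & Q = (Lam / lam) ^+ 2 * (1024 / (k ^+ 2 * a)) ^+ n.
  eexists; last by [].
  apply: mulr_ge0; first exact: sqr_ge0.
  apply/exprn_ge0/divr_ge0; first by rewrite ler0n.
  by apply: mulr_ge0; [exact: sqr_ge0|exact: ltW].
rewrite /slope_const -QE.
have [h0|h0] := leP h 0.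
  by apply: le_trans h0 _; apply: mulr_ge0; [lra|exact: ltW].
have z0x : 0 < enorm (z0 - x).
  rewrite lt_neqAle enorm_ge0 andbT eq_sym; apply/eqP => /enorm_eq0/eqP.
  by rewrite subr_eq0 => /eqP zx; move: h0; rewrite /h zx !subrr dot0r subrr ltxx.
have xT : v x <= T by rewrite gapxx ltW.
have z0T' := ltW z0T.
have dz0x : enorm (z0 - x) <= D by apply/ltW; exact: section_dist.
have dE1 : delta * D <= E1 / 8 by lra.
pose Epol := [set w : V | forall s s', v s <= T -> v s' <= T -> dot w (s - s') <= E1 / 8].
(* The largest [m] with [m E1 / h <= 1 / 2]: shift and polar body together then use at most
   [5 E1 / 8] of the margin [7 E1 / 8]. *)
pose m := Num.truncn (h / (2 * E1)).
have /andP[mh hm] : m%:R <= h / (2 * E1) < m.+1%:R.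
  by apply: truncn_itv; rewrite divr_ge0 ?ltW // mulr_gt0.
have {}mh : m%:R * (E1 / h) <= 2^-1.
  move: mh; rewrite ler_pdivlMr ?mulr_gt0 // mulrA ler_pdivrMr //; lra.
have {}hm : h <= m.+1%:R * (2 * E1) by rewrite -ler_pdivrMr ?mulr_gt0 // ltW.
pose e := (E1 / h) *: (q - p).
have E1h0 : 0 < E1 / h by rewrite divr_gt0.
have pack l : (forall w, w \in l ->
      exists2 w0, Epol w0 & exists2 j, (j <= m)%N & w = w0 + j%:R *: e) ->
    separated (2 * delta) l ->
  (((size l)%:R * (lam * bv delta))%:E <= mu [set s | (v s <= T)%R])%E.
  move=> lP ls; rewrite -(size_map (+%R p)); apply: (slope_packing z0T) => //.
    move=> _ s /mapP[_ /lP[w wE [j jm ->]] ->] sT.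
    have -> : p + (w + j%:R *: e) - p = w + j%:R *: e by rewrite addrC addKr.
    rewrite dotDl; have := wE _ _ sT z0T'.
    have : dot (j%:R *: e) (s - z0) <= 2^-1 * E1.
      rewrite /e scalerA dotZl.
      have c0 : 0 <= j%:R * (E1 / h) by rewrite mulr_ge0 // ltW.
      have h1 : dot (q - p) (s - z0) <= E1.
        have : subdiff psi z0 (p + (q - p)) by rewrite addrC subrK.
        by move/(gap_subdiff x s); rewrite /E1; lra.
      apply: le_trans (ler_wpM2l c0 h1) _; rewrite ler_pM2r //.
      by apply: le_trans mh; rewrite ler_pM2r // ler_nat.
    rewrite -/E1; lra.
  apply: separated_map ls => w w'.
  by rewrite opprD addrACA subrr add0r.
have muS1 : (mu [set s | (v s <= T)%R] <= 1)%E.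
  apply: probability_le1; exact: measurable_section.
have lb0 : 0 < lam * bv delta by rewrite mulr_gt0 // ball_vol_gt0.
pose N := Num.bound (1 / (lam * bv delta)).
have boundN l : (forall w, w \in l -> Epol w) -> separated (2 * delta) l -> (size l <= N)%N.
  move=> lP ls; have h1 : (((size l)%:R * (lam * bv delta))%:E <= 1)%E.
    apply: le_trans muS1; apply: pack => // w wl; exists w; first exact: lP.
    by exists 0%N; rewrite // scale0r addr0.
  move: h1; rewrite lee_fin -ler_pdivlMr // => h3.
  rewrite -(ler_nat R) (le_trans h3) //; apply/ltW/archi_boundP.
  by rewrite divr_ge0 // ltW.
have [l [lP ls lmax]] := packing_max boundN.
(* The slope 0 alone is a packing, so [size l] can be cancelled at the end. *)
have l1 : (1 <= size l)%N.
  apply: (lmax [:: 0]) => // w; rewrite inE => /eqP -> s s' _ _.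
  by rewrite dot0l divr_ge0 // ltW.
have [L [Ls Lsz LP]] : exists L, [/\ separated (2 * delta) L, size L = (m * size l)%N &
    forall q, q \in L -> exists2 w, w \in l & exists2 j, (j < m)%N & q = w + j%:R *: e].
  (* The shift [e] pairs with [z0 - x] to at least [E1], whereas the pairings of two members of [l]
     differ by at most [E1 / 4]. *)
  have eq_c : dot e (z0 - x) = E1 / h * (v z0 + h).
    by rewrite /e dotZl /h /gap !dotE; ring.
  have c1 : E1 <= E1 / h * (v z0 + h).
    by rewrite mulrDr divfK ?gt_eqF // lerDr mulr_ge0 // ltW.
  apply: (@translates _ e l (2 * delta) (E1 / 4) _ m ls eq_c _ _ z0x).
  - exact: le_trans (ltW E10) c1.
  - have : delta * enorm (z0 - x) <= delta * D by rewrite ler_wpM2l // ltW.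
    lra.
  - move=> w w' wl w'l; have h1 := lP _ wl _ _ z0T' xT; have h2 := lP _ w'l _ _ xT z0T'.
    by move: h1 h2; rewrite -(opprB z0 x) dotNr dotBl; lra.
have muS : (((m * size l)%:R * (lam * bv delta))%:E <= mu [set s | (v s <= T)%R])%E.
  rewrite -Lsz; apply: pack => // w /LP [w0 w0l [j jm ->]].
  by exists w0; [exact: lP|exists j; [exact: ltnW|]].
have [||A [AO muS_A muA_A Aw]] := section_core k0 k1 _ _ kO; [lra| |].
  have : k * a * T <= k * (2^-1 * T).
    by rewrite -mulrA ler_wpM2l ?(ltW k0) // ler_wpM2r // ltW.
  have : k * T <= k * (rho / 2) by rewrite ler_wpM2l // ltW.
  lra.
(* On the core the pairings are at most [4 T / (k a) <= 8 E1 / (k a)], that is [64 / (k a)] times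
   the bound [E1 / 8] of the polar body. *)
have ka64 : 0 < k * a / 64 by rewrite divr_gt0.
have muA_up : (mu (balls delta A) <=
    ((size l)%:R * (Lam * bv (2 * delta / (k * a / 64))))%:E)%E.
  apply: (slope_cover ka64 _ (E := E1 / 8) _ AO _ _ lmax).
  - lra.
  - by rewrite divr_gt0.
  - move=> z w s s' zA zw sT s'T; apply: le_trans (Aw _ _ _ _ zA zw sT s'T) _.
    rewrite ler_pdivrMr // (_ : _ * (k * a) = 8 * E1); last by field; rewrite !lt0r_neq0.
    lra.
  - rewrite ler_pdivrMr // mulrAC ler_pdivlMr //.
    have : k * a * T <= k * a * (rho / 2) by rewrite ler_wpM2l // ltW.
    lra.
have m_le : m%:R <= Q.
  have b0 := ball_vol_gt0 delta0.
  have -> : Q = (Lam / lam) ^+ 2 * ((8 / k) ^+ n * (128 / (k * a)) ^+ n).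
    rewrite QE -exprMn; congr (_ * _ ^+ _); field; rewrite !lt0r_neq0 //.
  apply: (count_bound lam0 b0 l1 (N := size A) (Lam := Lam)).
  - exact: le_trans (ltW lam0) lamLam.
  - by apply/exprn_ge0/divr_ge0; [rewrite ler0n|exact: ltW].
  - by rewrite -lee_fin -ball_volM; exact: le_trans muS muS_A.
  - rewrite -lee_fin -ball_volM (_ : 128 / (k * a) * delta = 2 * delta / (k * a / 64)).
      exact: le_trans muA_A muA_up.
    by field; rewrite !lt0r_neq0.
apply: le_trans hm _; rewrite -natr1.
have h1 : (m%:R + 1) * (2 * E1) <= (Q + 1) * (2 * E1).
  by rewrite ler_wpM2r ?lerD2r // mulr_ge0 // ltW.
apply: le_trans h1 _; rewrite [2 * (Q + 1)]mulrC -mulrA ler_wpM2l ?addr_ge0 //.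
by rewrite ler_wpM2l.
Qed.

End Key.

End Setting.

(** * Elementary inequalities and the exponent *)

Lemma expr_bernoulli (R : realFieldType) (t : R) (j : nat) : 0 <= t <= 1 ->
  (1 - t) ^+ j * (1 + j%:R * t) <= 1.
Proof.
move=> /andP[t0 t1]; elim: j => [|j IH]; first by rewrite mul0r addr0 mulr1.
apply: le_trans IH; rewrite exprS mulrC mulrA [leRHS]mulrC ler_wpM2r ?exprn_ge0 ?subr_ge0 //.
rewrite -natr1; have : 0 <= j%:R * t ^+ 2 by rewrite mulr_ge0 ?sqr_ge0.
have := sqr_ge0 t; rewrite !expr2; lra.
Qed.

Lemma slope_const_ge2 (R : realType) n lam Lam (k : R) : 0 < k ->
  2 <= slope_const n lam Lam k.
Proof.
move=> k0; rewrite /slope_const.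
have : 0 <= (Lam / lam) ^+ 2 * (1024 / (k ^+ 2 * center_ratio R n)) ^+ n.
  apply: mulr_ge0; first exact: sqr_ge0.
  apply/exprn_ge0/divr_ge0; first by rewrite ler0n.
  by apply: mulr_ge0; [exact: sqr_ge0|exact: ltW (center_ratio_gt0 R n)].
by move: (_ * _ ^+ n) => X; lra.
Qed.

(** The exponent [b] with [2^b = 2 + 1 / (2 Theta)]. The shrinking factor is 1 here, so only [n],
    [lam] and [Lam] enter. *)
Definition holder_exp (R : realType) (n : nat) (lam Lam : R) : R :=
  ln (2 + (2 * slope_const n lam Lam 1)^-1) / ln 2.

Section HolderExp.
Variables (R : realType) (n : nat) (lam Lam : R).
Local Notation c := (slope_const n lam Lam 1).

Lemma powR2_holder_exp : powR 2 (holder_exp n lam Lam) = 2 + (2 * c)^-1.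
Proof.
have c2 := slope_const_ge2 n lam Lam (ltr01 (R := R)).
have l2 : 0 < ln (2 : R) by rewrite ln_gt0 // ltr1n.
rewrite /powR gt_eqF // /holder_exp divfK ?gt_eqF // lnK // posrE.
by rewrite addr_gt0 // invr_gt0 mulr_gt0 //; lra.
Qed.

(** The upper bound is what makes [theta = 1 / (b - 1)] exceed 1. *)
Lemma holder_exp_bounds : 1 < holder_exp n lam Lam < 2.
Proof.
have c2 := slope_const_ge2 n lam Lam (ltr01 (R := R)).
have l2 : 0 < ln (2 : R) by rewrite ln_gt0 // ltr1n.
have ci : 0 < (2 * c)^-1 by rewrite invr_gt0; lra.
have ci1 : (2 * c)^-1 < 1 by rewrite invf_lt1; lra.
have p0 : 0 < 2 + (2 * c)^-1 by lra.
rewrite /holder_exp ltr_pdivlMr // mul1r ltr_ln ?posrE // ltrDl ci /=.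
rewrite ltr_pdivrMr // [ltRHS]mulr_natl -lnXn // ltr_ln ?posrE ?exprn_gt0 //.
by rewrite expr2; lra.
Qed.

End HolderExp.

(** * Small sections and decay along rays *)

Section Decay.
Variables (R : realType) (n : nat) (Om Om' : set 'rV[R]_n) (psi : 'rV[R]_n -> R).
Variables (delta lam Lam rho D M : R).
Local Notation V := 'rV[R]_n.
Local Notation cst := (slope_const n lam Lam).
Definition scale_const (k : R) := (64 * D + 4 * M) / (k * center_ratio R n).
Hypotheses (psic : convex_fun psi) (psi_cont : continuous psi).
Hypotheses (delta0 : 0 < delta) (rho0 : 0 < rho) (D0 : 0 < D) (M0 : 0 < M).
Hypotheses (Om'Om : Om' `<=` Om) (Om'R : cond_R psi Om Om' rho).
Hypothesis DP : forall a b, Om a -> Om b -> enorm (a - b) < D.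
Hypothesis MP : forall a b q r, Om a -> Om b -> subdiff psi a q ->
  subdiff psi b r -> enorm (q - r) <= M.
Hypothesis slopeP : forall x p T k z0 q, Om' x -> subdiff psi x p ->
  section psi x p rho `<=` Om -> 0 < T -> T <= rho / 2 ->
  0 < k -> k <= 1 -> scale_const k * delta <= T ->
  (forall s, gap psi x p s <= T -> Om' (x + k *: (s - x))) ->
  gap psi x p z0 <= T / 2 -> subdiff psi z0 q ->
  psi x - psi z0 - dot q (x - z0) <= cst k * T.

Section Strict.
Variables (d : R) (j : nat).
Hypothesis d0 : 0 < d.
Let k := Num.min 1 (d / (2 * D)).
Let tau := (2 * (2 * cst k + 1))^-1.
Let T0 := 2^-1 ^+ j * (rho / 4).
Hypothesis jP : (1 - tau) ^+ j * D <= d.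
Hypothesis deltaP : scale_const k * delta <= 2 * T0.

Let k0 : 0 < k.
Proof. by rewrite lt_min ltr01 /= divr_gt0 // mulr_gt0. Qed.

Let cst2 : 2 <= cst k := slope_const_ge2 n lam Lam k0.

Let tau0 : 0 < tau.
Proof. by rewrite invr_gt0; move: cst2; lra. Qed.

Let tau1 : tau <= 2^-1.
Proof. by rewrite lef_pV2 ?posrE //; move: cst2; lra. Qed.

Let T00 : 0 < T0.
Proof. by rewrite mulr_gt0 ?divr_gt0 // exprn_gt0. Qed.

Let T0rho : T0 <= rho / 4.
Proof. by rewrite ler_piMl ?divr_ge0 ?(ltW rho0) // exprn_ile1 // invf_le1 // ler1n. Qed.

(** At height [T = 2 * gap psi x p z], [slopeP] bounds the excess slope at [z] along [z - x] by
    [2 cst k + 1] times the gap; [tau] is chosen so that moving back by this fraction loses at most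
    half of it. The factor [k] keeps the shrunken section in the ball of radius [d]. *)
Lemma gap_shrink x p z : Om' x -> eball x d `<=` Om' -> subdiff psi x p ->
    section psi x p rho `<=` Om ->
    T0 <= gap psi x p z -> gap psi x p z <= rho / 4 ->
  gap psi x p z / 2 <= gap psi x p (x + (1 - tau) *: (z - x)).
Proof.
move=> Ox xd px Sx Tz zrho.
have [q qz] := subdiff_exists z psic.
pose T := 2 * gap psi x p z.
have z0 : 0 < gap psi x p z by exact: lt_le_trans T00 Tz.
have Trho : T <= rho / 2 by rewrite /T; lra.
have kO s : gap psi x p s <= T -> Om' (x + k *: (s - x)).
  move=> sT; apply: xd; rewrite /eball /= [x + _]addrC addrK enormZ gtr0_norm //.
  have sO : Om s by apply/Sx/sectionE; move: rho0; lra.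
  have sD := DP sO (Om'Om Ox).
  have kd : k <= d / (2 * D) by rewrite /k ge_min lexx orbT.
  apply: (@le_lt_trans _ _ (d / (2 * D) * D)).
    by rewrite ler_pM ?enorm_ge0 // ltW.
  have -> : d / (2 * D) * D = d / 2 by field; exact: lt0r_neq0.
  by rewrite ltr_pdivrMr // mulr_natr mulr2n ltrDl.
have k1 : k <= 1 by rewrite /k ge_min lexx.
have T0' : 0 < T by rewrite /T mulr_gt0.
have kT : scale_const k * delta <= T by apply: le_trans deltaP _; rewrite /T; lra.
have zT2 : gap psi x p z <= T / 2 by rewrite /T; lra.
have h := slopeP Ox px Sx T0' Trho k0 k1 kT kO zT2 qz.
have := qz (x + (1 - tau) *: (z - x)).
have -> : x + (1 - tau) *: (z - x) - z = - (tau *: (z - x)).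
  by apply/rowP => i; rewrite !mxE; ring.
rewrite -(opprB z x) dotNr in h; rewrite dotNr dotZr => h2.
have h3 : dot (q - p) (z - x) <= (2 * cst k + 1) * gap psi x p z.
  move: h; rewrite /T /gap dotBl; lra.
have := ler_wpM2l (ltW tau0) h3; rewrite mulrA.
have -> : tau * (2 * cst k + 1) = 2^-1.
  by rewrite /tau; field; rewrite lt0r_neq0 //; move: cst2; lra.
move: h2; rewrite {3}/gap [x + _ - x]addrC addKr dotZr dotBl => h4 h5.
have -> : psi (x + (1 - tau) *: (z - x)) - psi x - (1 - tau) * dot p (z - x) =
    psi (x + (1 - tau) *: (z - x)) - psi z + gap psi x p z + tau * dot p (z - x).
  by rewrite /gap; ring.
move: h4 h5; lra.
Qed.

(** Otherwise follow the ray from [x] through [z] to the level [rho / 4], reached within distance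
    [D], and retract [j] times with [gap_shrink]. The gap is then still at least [T0], at a point
    within distance [d] of [x], hence between [x] and [z]. *)
Lemma small_section x p z : Om' x -> eball x d `<=` Om' -> subdiff psi x p ->
    section psi x p rho `<=` Om ->
  gap psi x p z < T0 -> enorm (z - x) < d.
Proof.
move=> Ox xd px Sx zT; rewrite ltNge; apply/negP => dz.
have zx0 : 0 < enorm (z - x) := lt_le_trans d0 dz.
pose b := x + (D / enorm (z - x)) *: (z - x).
have bT : rho / 4 <= gap psi x p b.
  suff : rho < gap psi x p b by move: rho0; lra.
  rewrite ltNge; apply/negP => /sectionE/Sx/DP/(_ (Om'Om Ox)).
  rewrite /b addrC addKr enormZ gtr0_norm ?divr_gt0 //.
  by rewrite divfK ?gt_eqF // ltxx.
have vcont := gap_continuous psi_cont (x := x) (p := p).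
have [|t /andP[t0 t1] tT] := segment_value vcont (a := x) (b := b) (T := rho / 4) _ bT.
  by rewrite gapxx divr_ge0 // ltW.
move: tT; rewrite /b [x + _ - x]addrC addKr scalerA; set t' := t * _ => tT.
have t'0 : 0 <= t' by rewrite mulr_ge0 // divr_ge0 // ltW.
pose u i := x + (1 - tau) ^+ i *: (t' *: (z - x)).
have tau01 : 0 <= 1 - tau <= 1 by move: tau0 tau1; lra.
have step i : (i <= j)%N -> 2^-1 ^+ i * (rho / 4) <= gap psi x p (u i) <= rho / 4.
  elim: i => [_|i IH ij]; first by rewrite /u !expr0 scale1r tT mul1r lexx.
  have /andP[i1 i2] := IH (ltnW ij).
  have uS : u i.+1 = x + (1 - tau) *: (u i - x).
    by rewrite /u; apply/rowP => l; rewrite !mxE exprS; ring.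
  apply/andP; split; last first.
    rewrite uS; apply: le_trans i2.
    apply: le_trans (gap_seg psic _ px tau01) _.
    by rewrite ler_piMl ?gap_ge0 //; case/andP: tau01.
  have Tu : T0 <= gap psi x p (u i).
    apply: le_trans i1; rewrite /T0 ler_pM2r ?divr_gt0 //.
    by apply: ler_wiXn2l; [rewrite invr_ge0|rewrite invf_le1 // ler1n|exact: ltnW].
  rewrite uS; apply: le_trans (gap_shrink Ox xd px Sx Tu i2).
  by rewrite exprSr; lra.
have /andP[uj _] := step j (leqnn j).
have : gap psi x p (u j) <= gap psi x p z.
  rewrite /u scalerA; set r := _ * t'.
  have r0 : 0 <= r by rewrite mulr_ge0 // exprn_ge0 //; case/andP: tau01.
  have r1 : r <= 1.
    have r1D : r * enorm (z - x) <= d.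
      have -> : r * enorm (z - x) = (1 - tau) ^+ j * (t * D).
        by rewrite /r /t'; field; exact: lt0r_neq0.
      apply: le_trans jP; rewrite ler_wpM2l ?ler_piMl ?(ltW D0) //.
      by rewrite exprn_ge0 //; case/andP: tau01.
    by rewrite -(ler_pM2r zx0) mul1r (le_trans r1D).
  apply: le_trans (gap_seg psic z px _) _; first by rewrite r0.
  by rewrite ler_piMl ?gap_ge0.
move: uj zT; rewrite -/T0; lra.
Qed.

(** Sections below [T0] lie in the ball of radius [d], so [slopeP] applies with shrinking factor 1.
    The maximum keeps the height at a scale where [slopeP] is available. *)
Lemma quasi_symmetry x p y q : Om' x -> eball x d `<=` Om' -> subdiff psi x p ->
    section psi x p rho `<=` Om -> subdiff psi y q ->
    2 * gap psi x p y < T0 -> scale_const k * delta < T0 ->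
  psi x - psi y - dot q (x - y) <=
    cst 1 * Num.max (2 * gap psi x p y) (scale_const k * delta).
Proof.
move=> Ox xd px Sx qy yT kT.
set T := Num.max _ _.
have TT0 : T < T0 by rewrite gt_max yT.
have sc1 : 0 < scale_const k.
  rewrite divr_gt0 ?addr_gt0 ?mulr_gt0 //; exact: center_ratio_gt0.
have kT' : scale_const k * delta <= T by rewrite le_max lexx orbT.
have T0' : 0 < T by apply: lt_le_trans kT'; rewrite mulr_gt0.
apply: (slopeP Ox px Sx T0' _ ltr01 (lexx 1) _ _ _ qy).
- by move: T0rho TT0 rho0; lra.
- apply: le_trans kT'; rewrite ler_pM2r // /scale_const ler_pM2l; last first.
    by rewrite addr_gt0 ?mulr_gt0.
  rewrite lef_pV2 ?posrE ?mulr_gt0 ?center_ratio_gt0 //.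
  by rewrite ler_pM2r ?center_ratio_gt0 // /k ge_min lexx.
- move=> s sT; rewrite scale1r addrC subrK; apply/xd.
  exact: (small_section Ox xd px Sx (le_lt_trans sT TT0)).
have : 2 * gap psi x p y <= T by rewrite le_max lexx.
lra.
Qed.

Lemma doubling y q u s : Om' y -> subdiff psi y q -> enorm u = 1 ->
    eball y (2 * d) `<=` Om' -> 0 < s -> s <= d -> 4 * M * s <= T0 ->
    scale_const k * delta < T0 ->
  let f r := gap psi y q (y + r *: u) in
  f s <= cst 1 * (scale_const k * delta) \/ (2 + (2 * cst 1)^-1) * f s <= f (2 * s).
Proof.
move=> Oy qy u1 yd s0 sd sT kT f.
pose x := y + s *: u.
have nxy : enorm (x - y) = s by rewrite /x addrC addKr enormZ u1 mulr1 gtr0_norm.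
have Ox : Om' x by apply: yd; rewrite /eball /= nxy; lra.
have xd : eball x d `<=` Om'.
  move=> z; rewrite /eball /= => zx; apply: yd; rewrite /eball /=.
  by apply: le_lt_trans (enorm_dist_triangle x _ _) _; rewrite nxy; lra.
have [p px Sx] := Om'R Ox.
have xy : x - y = s *: u by rewrite /x addrC addKr.
have yx : y - x = - (s *: u) by rewrite -xy opprB.
(* This gap is [s f'(s) - f s], with the derivative read off from the slope [p]. *)
have tE : gap psi x p y = - f s + s * dot (p - q) u.
  by rewrite /f -/x /gap yx xy dotNr !dotZr dotBl; ring.
have f0 : 0 <= f s := gap_ge0 _ qy.
have sM : s * dot (p - q) u <= M * s.
  rewrite [M * s]mulrC ler_pM2l //; apply: le_trans (dot_enorm _ _) _.
  by rewrite u1 mulr1; apply: (MP (Om'Om Ox) (Om'Om Oy)).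
have := quasi_symmetry Ox xd px Sx qy _ kT.
have -> : 2 * gap psi x p y < T0.
  by rewrite tE; have := mulr_gt0 M0 s0; lra.
move=> /(_ isT); rewrite xy dotZr.
have -> : psi x - psi y - s * dot q u = f s by rewrite /f -/x /gap xy dotZr.
have c2 : 2 <= cst 1 := slope_const_ge2 n lam Lam ltr01.
rewrite maxr_pMr ?le_max; last by lra.
case/orP => h; [right|by left].
have f2 : f s + s * dot (p - q) u <= f (2 * s).
  have := px (y + (2 * s) *: u); rewrite /f /gap -/x.
  have -> : y + (2 * s) *: u - x = s *: u.
    by rewrite /x; apply/rowP => i; rewrite !mxE; ring.
  have -> : y + (2 * s) *: u - y = (2 * s) *: u by rewrite addrC addKr.
  by rewrite xy !dotZr dotBl; lra.
have h2 : (2 * cst 1)^-1 * f s <= gap psi x p y.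
  by rewrite ler_pdivrMl; lra.
move: h2; rewrite tE; lra.
Qed.

Lemma gap_le_dist y q x : Om y -> subdiff psi y q -> Om x ->
  gap psi y q x <= M * enorm (x - y).
Proof.
move=> Oy qy Ox; have [p px] := subdiff_exists x psic.
have := px y; have := dot_enorm (p - q) (x - y).
have := MP Ox Oy px qy => /(ler_wpM2r (enorm_ge0 (x - y))).
by rewrite /gap -(opprB x y) dotNr dotBl; lra.
Qed.

(** Induction on the number of doublings that bring [s] up to [s0]. On the last dyadic interval the
    linear bound suffices; below it, the factor gained in [doubling] is exactly the factor [2^b] by
    which the power grows. *)
Lemma decay y q u s0 B s : Om' y -> subdiff psi y q -> enorm u = 1 ->
    eball y (2 * d) `<=` Om' -> s0 <= d -> 4 * M * s0 <= T0 ->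
    scale_const k * delta < T0 ->
    M * s0 <= B * powR (s0 / 2) (holder_exp n lam Lam) ->
    cst 1 * scale_const k <= B ->
    0 < s -> s <= s0 -> delta <= powR s (holder_exp n lam Lam) ->
  gap psi y q (y + s *: u) <= B * powR s (holder_exp n lam Lam).
Proof.
move=> Oy qy u1 yd s0d s0T kT B1 B2 s_gt0 ss0; set b := holder_exp n lam Lam.
have s00 : 0 < s0 := lt_le_trans s_gt0 ss0.
have b0 : 0 <= b by have /andP[] := holder_exp_bounds n lam Lam; rewrite -/b; lra.
have c2 : 2 <= cst 1 := slope_const_ge2 n lam Lam ltr01.
have sc0 : 0 < scale_const k.
  by rewrite divr_gt0 ?addr_gt0 ?mulr_gt0 //; exact: center_ratio_gt0.
have B0 : 0 <= B by apply: le_trans B2; rewrite mulr_ge0 ?(ltW sc0) //; lra.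
have [N sN] : exists N, s0 <= 2 ^+ N.+1 * s.
  exists (Num.bound (s0 / s)); rewrite -ler_pdivrMr //.
  apply: (@le_trans _ _ (Num.bound (s0 / s))%:R).
    by apply/ltW/archi_boundP; rewrite divr_ge0 // ltW.
  by rewrite -natrX ler_nat ltnW // ltnW // ltn_expl.
elim: N s s_gt0 ss0 sN => [|N IH] s sp ss0 sN ds.
  have s2 : s0 / 2 <= s by rewrite ler_pdivrMr // mulrC -[2]expr1.
  have Os : Om (y + s *: u).
    by apply/Om'Om/yd; rewrite /eball /= addrC addKr enormZ u1 mulr1 gtr0_norm //; have := d0; lra.
  apply: le_trans (gap_le_dist (Om'Om Oy) qy Os) _.
  rewrite [y + _]addrC addrK enormZ u1 mulr1 gtr0_norm //.
  apply: (@le_trans _ _ (M * s0)); first by rewrite ler_pM2l.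
  apply: le_trans B1 _; rewrite ler_wpM2l // ge0_ler_powR // nnegrE ?(ltW sp) //.
  by rewrite divr_ge0 // ltW.
have [s2|s2] := leP (2 * s) s0; last first.
  apply: (IH s) => //; rewrite (le_trans (ltW s2)) // ler_pM2r //.
  by rewrite exprS ler_peMr // exprn_ege1 // ler1n.
have sd : s <= d by lra.
have sT : 4 * M * s <= T0.
  by apply: le_trans s0T; rewrite ler_pM2l // mulr_gt0.
have [h|h] := doubling Oy qy u1 yd sp sd sT kT.
  apply: le_trans h _; rewrite mulrA.
  apply: (@le_trans _ _ (B * delta)); first by rewrite ler_pM2r.
  by rewrite ler_wpM2l.
have s20 : 0 < 2 * s by rewrite mulr_gt0.
have pE : powR (2 * s) b = (2 + (2 * cst 1)^-1) * powR s b.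
  by rewrite powRM // ?(ltW sp) // powR2_holder_exp.
have ci : 0 < (2 * cst 1)^-1 by rewrite invr_gt0; lra.
have c0 : 0 < 2 + (2 * cst 1)^-1 by rewrite addr_gt0.
rewrite -(ler_pM2l c0); apply: le_trans h _; rewrite mulrCA -pE.
apply: IH => //; first by rewrite mulrA -exprSr.
by apply: le_trans ds _; rewrite pE ler_peMl ?powR_ge0 //; lra.
Qed.

End Strict.
End Decay.

(** * Choice of the constants *)

Lemma expr_small (R : realType) (t e : R) : 0 < t -> t <= 1 -> 0 < e ->
  exists j, (1 - t) ^+ j <= e.
Proof.
move=> t0 t1 e0; exists (Num.bound ((e * t)^-1)).
set j := Num.bound _; have jP : (e * t)^-1 < j%:R.
  by apply: archi_boundP; rewrite invr_ge0 mulr_ge0 // ltW.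
have := @expr_bernoulli _ t j; rewrite (ltW t0) t1 => /(_ isT) h.
have jt : e^-1 <= j%:R * t.
  by rewrite -ler_pdivrMr // -invfM ltW.
have e1 : e^-1 <= 1 + j%:R * t by apply: le_trans jt _; rewrite lerDr.
have p0 : 0 <= (1 - t) ^+ j by rewrite exprn_ge0 // subr_ge0.
by have := le_trans (ler_wpM2l p0 e1) h; rewrite ler_pdivrMr // mul1r.
Qed.

(** The domains, [psi] and [delta] are quantified after the constants, so these depend on the listed
    parameters only. The measures enter through the slope estimate alone, which is a premise. *)
Definition decay_constants (R : realType) (n : nat) (lam Lam rho D M d C Cbar : R) :=
  forall (Om Om' : set 'rV[R]_n) (psi : 'rV[R]_n -> R) (delta : R),
  convex_fun psi -> continuous psi -> 0 < delta -> Om' `<=` Om ->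
  cond_R psi Om Om' rho ->
  (forall a b, Om a -> Om b -> enorm (a - b) < D) ->
  (forall a b q r, Om a -> Om b -> subdiff psi a q -> subdiff psi b r ->
    enorm (q - r) <= M) ->
  (forall x p T k z0 q, Om' x -> subdiff psi x p ->
    section psi x p rho `<=` Om -> 0 < T -> T <= rho / 2 ->
    0 < k -> k <= 1 -> scale_const n D M k * delta <= T ->
    (forall s, gap psi x p s <= T -> Om' (x + k *: (s - x))) ->
    gap psi x p z0 <= T / 2 -> subdiff psi z0 q ->
    psi x - psi z0 - dot q (x - z0) <= slope_const n lam Lam k * T) ->
  forall y q x, Om' y -> subdiff psi y q -> Om' x -> eball y d `<=` Om' ->
    C * powR delta (holder_exp n lam Lam)^-1 <= enorm (x - y) ->
    enorm (x - y) <= d ->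
    gap psi y q x <= Cbar * powR (enorm (x - y)) (holder_exp n lam Lam).

Lemma decay_constants_exist (R : realType) (n : nat) (lam Lam rho D M d : R) :
    0 < rho -> 0 < D -> 0 < M -> 0 < d ->
  exists C Cbar, [/\ 0 < C, 0 < Cbar &
    decay_constants n lam Lam rho D M d C Cbar].
Proof.
move=> rho0 D0 M0 d0.
pose b := holder_exp n lam Lam.
have b1 : 0 < b by have /andP[] := holder_exp_bounds n lam Lam; rewrite -/b; lra.
(* Half of [d], because [doubling] uses balls of radius [d'] around points at distance up to [d']
   from [y]. *)
pose d' := d / 2; have d'0 : 0 < d' by rewrite divr_gt0.
pose k := Num.min 1 (d' / (2 * D)).
have k0 : 0 < k by rewrite lt_min ltr01 /= divr_gt0 // mulr_gt0.
pose tau := (2 * (2 * slope_const n lam Lam k + 1))^-1.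
have c2 := slope_const_ge2 n lam Lam k0.
have tau0 : 0 < tau by rewrite invr_gt0; lra.
have tau1 : tau <= 1 by rewrite invf_le1; lra.
have [j jP] := expr_small tau0 tau1 (divr_gt0 d'0 D0).
rewrite ler_pdivlMr // in jP.
pose T0 := 2^-1 ^+ j * (rho / 4).
have T00 : 0 < T0 by rewrite mulr_gt0 ?divr_gt0 // exprn_gt0.
pose K := scale_const n D M k.
have K0 : 0 < K.
  by rewrite divr_gt0 ?addr_gt0 ?mulr_gt0 //; exact: center_ratio_gt0.
pose s0 := Num.min d' (T0 / (4 * M)).
have s00 : 0 < s0 by rewrite lt_min d'0 divr_gt0 // mulr_gt0.
have s0d : s0 <= d' by rewrite ge_min lexx.
have s0T : 4 * M * s0 <= T0.
  by rewrite mulrC -ler_pdivlMr ?mulr_gt0 // ge_min lexx orbT.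
pose delta1 := T0 / (2 * K).
have delta10 : 0 < delta1 by rewrite divr_gt0 // mulr_gt0.
pose P := powR delta1 b^-1; have P0 : 0 < P by exact: powR_gt0.
(* The second summand makes the range of distances empty unless [delta <= delta1]; the first gives
   [delta <= s^b]. *)
pose C := 1 + d / P.
have C1 : 1 <= C by rewrite lerDl divr_ge0 // ltW.
pose c1 := slope_const n lam Lam 1.
have c12 : 2 <= c1 := slope_const_ge2 n lam Lam ltr01.
pose Q := powR (s0 / 2) b; have Q0 : 0 < Q by rewrite powR_gt0 // divr_gt0.
(* The first summand covers distances above [s0 / 2], the second the alternative of order [delta] in
   [doubling]. *)
pose B := M * d / Q + c1 * K.
have MdQ : 0 < M * d / Q by rewrite divr_gt0 // mulr_gt0.
have cK0 : 0 < c1 * K by rewrite mulr_gt0 //; lra.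
have MdB : M * d <= B * Q.
  by rewrite -ler_pdivrMr // lerDl ltW.
exists C, B; split; [by lra|by rewrite addr_gt0|].
move=> Om Om' psi delta psic psi_cont delta0 Om'Om Om'R DP MP slopeP.
move=> y q x Oy qy Ox yd Cs sd.
pose pd := powR delta b^-1; have pd0 : 0 < pd by exact: powR_gt0.
set s := enorm (x - y) in Cs sd *.
have pds : pd <= s by apply: le_trans Cs; rewrite ler_peMl // ltW.
have s_gt0 : 0 < s := lt_le_trans pd0 pds.
have powK (t : R) : 0 <= t -> powR (powR t b^-1) b = t.
  by move=> t0; rewrite -powRrM mulVf ?gt_eqF // powRr1.
have ds : delta <= powR s b.
  rewrite -[leLHS](powK _ (ltW delta0)).
  by apply: ge0_ler_powR => //; rewrite ?nnegrE ltW.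
have delta_le : delta <= delta1.
  rewrite -[leLHS](powK _ (ltW delta0)) -[leRHS](powK _ (ltW delta10)).
  apply: ge0_ler_powR; [exact: ltW|by rewrite nnegrE ltW|by rewrite nnegrE ltW|].
  rewrite -/pd -/P; have h : C * pd <= d := le_trans Cs sd.
  have {}h : d / P * pd <= d.
    by apply: le_trans _ h; apply: (ler_wpM2r (ltW pd0)); rewrite /C lerDr.
  by move: h; rewrite mulrAC ler_pdivrMr // ler_pM2l.
have KT : K * delta < T0.
  have := ler_wpM2l (ltW K0) delta_le.
  have -> : K * delta1 = T0 / 2 by rewrite /delta1; field; exact: lt0r_neq0.
  lra.
have [ss0|ss0] := leP s s0.
  pose u := s^-1 *: (x - y).
  have u1 : enorm u = 1 by rewrite enormZ gtr0_norm ?invr_gt0 // mulVf ?gt_eqF.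
  have xE : x = y + s *: u.
    by rewrite /u scalerA divff ?gt_eqF // scale1r addrC subrK.
  rewrite {1}xE; apply: (decay psic psi_cont delta0 rho0 D0 M0 Om'Om Om'R DP MP
    slopeP d'0 jP _ Oy qy u1 _ s0d s0T KT) => //.
  - by rewrite -/K -/T0; lra.
  - by rewrite (_ : 2 * d' = d) // /d'; field.
  - apply: le_trans MdB; rewrite ler_pM2l //; apply: le_trans s0d _.
    by rewrite /d'; lra.
  - by rewrite lerDr ltW.
apply: le_trans (gap_le_dist psic MP (Om'Om _ Oy) qy (Om'Om _ Ox)) _.
rewrite -/s; apply: (@le_trans _ _ (M * d)); first by rewrite ler_pM2l.
apply: le_trans MdB _; apply: ler_wpM2l; first by apply/ltW/addr_gt0.
have s02 : 0 < s0 / 2 by rewrite divr_gt0.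
apply: ge0_ler_powR; [exact: ltW|by rewrite nnegrE ltW|by rewrite nnegrE ltW|lra].
Qed.

(** * Enclosing radii and distance to the boundary *)

Section Radius.
Variables (R : realType) (n : nat).
Implicit Types (K A : set 'rV[R]_n).

Lemma Lrad_ge0 K : 0 <= Lrad K.
Proof.
rewrite /Lrad; set X := [set r | _].
have [X0|/set0P X0] := eqVneq X set0; first by rewrite X0 inf0.
by apply: lb_le_inf => // r [].
Qed.

(** The [+ 1] leaves room for an enclosing ball whose radius only approaches the infimum. *)
Lemma Lrad_dist K a b : Defs.bounded_set K -> K a -> K b ->
  enorm (a - b) < 2 * (Lrad K + 1).
Proof.
move=> [B BP] Ka Kb.
have hi : has_inf [set r : R | 0 <= r /\ exists c : 'rV_n, K `<=` ecball c r].
  split; last by exists 0 => r [].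
  exists `|B|; split=> //; exists 0 => x Kx.
  by rewrite /ecball /= subr0 (le_trans (BP x Kx)) // ler_norm.
have [r [r0 [c Kc]] rL] := inf_adherent (ltr01 : 0 < 1 :> R) hi.
have := Kc a Ka; have := Kc b Kb; rewrite /ecball /= (enormB b) => bc ac.
have := enorm_dist_triangle c a b; rewrite -/(Lrad K) in rL; lra.
Qed.

(* The last point before leaving an open set along a segment is a boundary point. *)
Lemma eball_dist_boundary A y : open A -> A y ->
  eball y (dist_to_set y (boundary A)) `<=` A.
Proof.
move=> Ao Ay z; rewrite /eball /= => zy; apply: contrapT => nAz.
pose X := [set t : R | 0 <= t <= 1 /\ ~ A (y + t *: (z - y))].
have X1 : X 1 by rewrite /X /= ler01 lexx scale1r addrC subrK.
have hi : has_inf X by split; [exists 1|exists 0 => t [/andP[]]].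
pose t := inf X; pose b := y + t *: (z - y).
have t0 : 0 <= t by apply: lb_le_inf => [|r [/andP[]]]; [exists 1|].
have t1 : t <= 1 := ge_inf hi.2 X1.
have dist r : enorm (y + r *: (z - y) - b) = `|r - t| * enorm (z - y).
  by rewrite -enormZ; congr enorm; rewrite /b; apply/rowP => i; rewrite !mxE; ring.
have zy0 : 0 < enorm (z - y) + 1 by rewrite ltr_wpDl ?enorm_ge0.
have nAb : ~ A b.
  move=> /(open_has_eball Ao)[e e0 eA].
  have [r [r01 nAr] rt] := inf_adherent (divr_gt0 e0 zy0) hi.
  have tr : t <= r := ge_inf hi.2 (conj r01 nAr).
  apply: nAr; apply: eA; rewrite /eball /= dist.
  rewrite ger0_norm ?subr_ge0 //.
  have {}rt : (r - t) * (enorm (z - y) + 1) < e.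
    by rewrite -ltr_pdivlMr //; rewrite -/t in rt; lra.
  apply: le_lt_trans rt; rewrite ler_wpM2l ?subr_ge0 // lerDl //.
have tp : 0 < t.
  rewrite lt_neqAle t0 andbT; apply/eqP => te; apply: nAb.
  by rewrite /b -te scale0r addr0.
have bA : boundary A b.
  split; last by move=> /interior_subset.
  apply/closure_has_eball => e e0.
  pose r := Num.max 0 (t - e / (2 * (enorm (z - y) + 1))).
  have d0 : 0 < e / (2 * (enorm (z - y) + 1)) by rewrite divr_gt0 // mulr_gt0.
  have rt : r < t by rewrite gt_max tp gtrBl.
  exists (y + r *: (z - y)).
    apply: contrapT => nAr; have : t <= r.
      apply: ge_inf; first exact: hi.2.
      by split=> //; rewrite le_max lexx (le_trans (ltW rt)).
    by rewrite leNgt rt.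
  rewrite dist distrC ger0_norm ?subr_ge0 ?(ltW rt) //.
  have h : t - r <= e / (2 * (enorm (z - y) + 1)).
    have : t - e / (2 * (enorm (z - y) + 1)) <= r by rewrite le_max lexx orbT.
    lra.
  apply: le_lt_trans (ler_wpM2r (enorm_ge0 _) h) _.
  rewrite mulrAC ltr_pdivrMr ?mulr_gt0 // ltr_pM2l //.
  have := enorm_ge0 (z - y); lra.
have : dist_to_set y (boundary A) <= enorm (y - b).
  apply: ge_inf; last by exists b.
  by exists 0 => _ [c _ <-]; exact: enorm_ge0.
rewrite enormB /b addrC addKr enormZ ger0_norm //.
have := ler_wpM2r (enorm_ge0 (z - y)) t1; lra.
Qed.

End Radius.

(** * Constants as functions of the parameters, and the conclusion *)

Unset Implicit Arguments.
Set Strict Implicit.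

Theorem mainTheorem1 (R : realType) (n : nat) (hn : (0 < n)%N) :
  exists (C0 : R -> R -> R)          (* C0 (L Omega) (L (dpsi Omega)) *)
         (theta beta : R -> R -> R)  (* theta lambda Lambda, beta lambda Lambda *)
         (C Cbar : R -> R -> R -> set 'rV[R]_n -> R -> R -> R),
           (* C (dist (y, dOmega')) rho (L (dpsi Omega)) Omega lambda Lambda *)
    (forall a b, 0 < C0 a b) /\
    (forall a b, 1 < theta a b) /\
    (forall a b, 0 < beta a b) /\
    (forall d r l Om a b, 0 < C d r l Om a b) /\
    (forall d r l Om a b, 0 < Cbar d r l Om a b) /\
    forall (Om Oc : set 'rV[R]_n) (mu nu : probability (borelV R n) R)
           (delta lam Lam : R) (psi : 'rV[R]_n -> R),
      bounded_convex_open Om -> bounded_convex_open Oc ->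
      spt mu `<=` closure Om -> spt nu `<=` closure Oc ->
      0 < delta ->
      assumption_A Om Oc mu nu delta lam Lam ->
      convex_fun psi ->
      (* (O) *)
      subdiff_img psi [set: 'rV[R]_n] `<=` closure Oc ->
      (* (I1) *)
      (forall A : set (borelV R n), measurable A -> A `<=` Om ->
         (mu A <= mstar nu (subdiff_img psi A))%E) ->
      (* (I2) *)
      (forall B : set (borelV R n), measurable B -> B `<=` Oc ->
         (nu B <= mstar mu (esubdiff_img (legendre psi) B))%E) ->
      forall (Om' : set 'rV[R]_n) (rho : R),
        cc_sub Om' Om ->
        C0 (Lrad Om) (Lrad (subdiff_img psi Om)) * delta < rho ->
        cond_R psi Om Om' rho ->
        forall y, Om' y ->
        let d := dist_to_set y (boundary Om') in
        let Lp := Lrad (subdiff_img psi Om) in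
        forall q x, subdiff psi y q -> Om' x ->
          C d rho Lp Om lam Lam * powR delta (beta lam Lam)^-1 <= enorm (x - y) ->
          enorm (x - y) <= d ->
          2 * Lp * enorm (x - y) <= rho ->
          0 <= psi x - psi y - dot q (x - y) /\
          psi x - psi y - dot q (x - y)
            <= Cbar d rho Lp Om lam Lam *
               powR (enorm (x - y)) (1 + (theta lam Lam)^-1).
Proof.
(* The constants must be positive for all real arguments; when one of [d], [r], [D], [M] is not
   positive, the default pair [(1, 1)] is taken. *)
have H (d r D M a b : R) : exists Cs : R * R, [/\ 0 < Cs.1, 0 < Cs.2 &
    0 < r -> 0 < D -> 0 < M -> 0 < d -> decay_constants n a b r D M d Cs.1 Cs.2].
  have [[[r0 D0] [M0 d0]]|h] := pselect ((0 < r /\ 0 < D) /\ (0 < M /\ 0 < d)).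
    have [C [Cb [C0 Cb0 CP]]] := decay_constants_exist n a b r0 D0 M0 d0.
    by exists (C, Cb).
  by exists (1, 1); split=> // r0 D0 M0 d0; case: h.
pose Cs (d r l : R) (Om : set 'rV[R]_n) (a b : R) :=
  projT1 (cid (H d r (2 * (Lrad Om + 1)) (2 * (l + 1)) a b)).
have CsP (d r l : R) (Om : set 'rV[R]_n) (a b : R) :=
  projT2 (cid (H d r (2 * (Lrad Om + 1)) (2 * (l + 1)) a b)).
exists (fun _ _ => 1), (fun a b => (holder_exp n a b - 1)^-1), (fun a b => holder_exp n a b).
exists (fun d r l Om a b => (Cs d r l Om a b).1), (fun d r l Om a b => (Cs d r l Om a b).2).
split=> [//|]; split=> [a b|].
  have /andP[h1 h2] := holder_exp_bounds n a b.
  by rewrite invf_gt1 ?subr_gt0 //; lra.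
split=> [a b|]; first by have /andP[] := holder_exp_bounds n a b; lra.
split=> [d r l Om a b|]; first by have [] := CsP d r l Om a b.
split=> [d r l Om a b|]; first by have [] := CsP d r l Om a b.
move=> Om Oc mu nu delta lam Lam psi OmP OcP _ _ delta0 muA psic psiO I1 I2.
move=> Om' rho [Om'o [_ Om'Om]] rhod Om'R y Oy d Lp q x qy Ox dx xd _.
have [C0 _ CP] := CsP d rho Lp Om lam Lam.
rewrite invrK [1 + _]addrC subrK.
have rho0 : 0 < rho by apply: lt_trans rhod; rewrite mul1r.
(* Positivity of [d] is read off from the admissible range of [enorm (x - y)], whose lower end is
   positive. *)
have d0 : 0 < d.
  apply: lt_le_trans xd; apply: lt_le_trans dx; apply: mulr_gt0 => //.
  exact: powR_gt0.
have subOm : Om' `<=` Om by move=> z Oz; apply/Om'Om/subset_closure.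
have psi_cont := psi_continuous OcP psic psiO.
have [_ [Omb _]] := OmP; have [_ [[B BP] _]] := OcP.
have DP a b : Om a -> Om b -> enorm (a - b) < 2 * (Lrad Om + 1).
  exact: Lrad_dist.
have MP a b p r : Om a -> Om b -> subdiff psi a p -> subdiff psi b r ->
    enorm (p - r) <= 2 * (Lp + 1).
  move=> Oa Ob pa rb; apply/ltW/Lrad_dist; [|by exists a|by exists b].
  exists (B + 1) => w [z _ zw]; have /psiO : subdiff_img psi setT w by exists z.
  case/closure_has_eball/(_ 1 ltr01) => v /BP vB vw.
  by have := ler_enormD (w - v) v; rewrite subrK enormB; lra.
have D0 : 0 < 2 * (Lrad Om + 1) by have := Lrad_ge0 Om; lra.
have M0 : 0 < 2 * (Lp + 1) by have := Lrad_ge0 (subdiff_img psi Om); rewrite -/Lp; lra.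
split; first exact: gap_ge0.
apply: (CP rho0 D0 M0 d0 Om Om' psi delta) => //; last exact: eball_dist_boundary.
move=> x0 p T k z0 q0 Ox0 px0 Sx0 T0 Trho k0 k1 kT kO z0T qz0.
exact: (slope_bound OmP OcP delta0 muA psic psiO I1 I2 rho0 Om'o Om'Om Om'R DP MP D0 M0
  Ox0 px0 Sx0 T0 Trho k0 k1 kT kO z0T qz0).
Qed.
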